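(* Pseudoentangled state ensembles with entropy $S_2=O(\log n)$ can have a pseudoentanglement gap of at most $f(n)=\Theta(n)$ versus $g(n)=\omega(\log n)$, where entanglement is measured by both the PT negativity $\mathcal{E}(\rho)$ and the fidelity of separability $D_{\mathrm F}(\rho)$. That is, in such a pseudoentangled pair of ensembles the high-entanglement value is at most $f(n)=\Theta(n)$, and a low-entanglement value $g(n)=O(\log n)$ cannot occur together with $f(n)=\omega(\log n)$.
   Context: States are $n$-qubit density matrices with a given bipartition $A|B$. $S_2(\rho)=-\ln\mathrm{tr}(\rho^2)$. PT negativity: $\mathcal{E}(\rho)=\ln\|\rho^\Gamma\|_1$, with partial transpose $(X_A\otimes Y_B)^\Gamma=X_A\otimes Y_B^T$. Fidelity of separability: $D_{\mathrm F}(\rho)=\min_{\sigma\in\mathrm{SEP}}-\ln\mathcal{F}(\rho,\sigma)$, with SEP the states separable across $A|B$ and $\mathcal{F}(\rho,\sigma)=\big(\mathrm{tr}\sqrt{\sqrt\rho\,\sigma\sqrt\rho}\big)^2$. A pseudoentangled state ensemble with gap $f(n)$ vs $g(n)$ consists of two ensembles of $n$-qubit states $\rho_k$ and $\sigma_k$, indexed by a key $k\in\{0,1\}^{\mathrm{poly}(n)}$, such that: (1) given $k$, $\rho_k$ (respectively $\sigma_k$) is efficiently preparable by a uniform, polynomial-sized quantum circuit; (2) with probability $\ge 1-1/\mathrm{poly}(n)$ over the choice of $k$, both the PT negativity and $D_{\mathrm F}$ of $\rho_k$ (respectively $\sigma_k$) are $\Theta(f(n))$ (respectively $\Theta(g(n))$);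 (3) no polynomial-time quantum algorithm can distinguish the two ensembles given polynomially many copies with more than negligible probability: for any polynomial-time quantum algorithm $\mathcal{A}$, $\big|\Pr_k[\mathcal{A}(\rho_k^{\otimes\mathrm{poly}(n)})=1]-\Pr_k[\mathcal{A}(\sigma_k^{\otimes\mathrm{poly}(n)})=1]\big|=\mathrm{negl}(n)$. The entropy assumption applies to the states of both ensembles. *)

(* Defs.v *)
From HB Require Import structures.
From mathcomp Require Import all_boot all_order all_algebra.
From mathcomp Require Import spectral.
From mathcomp Require Import complex.
From mathcomp Require Import all_classical all_reals all_analysis.

Set Implicit Arguments.
Unset Strict Implicit.
Unset Printing Implicit Defensive.

Import Order.TTheory GRing.Theory Num.Theory.
Import numFieldNormedType.Exports.

Local Open Scope classical_set_scope.
Local Open Scope ring_scope.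
Local Open Scope sesquilinear_scope.

(* The wires of a register form a finType W; the computational basis is the   *)
(* set of bit assignments W -> bool, and operators are matrices indexed by    *)
(* the canonical enumeration of that basis.                                   *)

Notation bits W := {ffun W -> bool}.
Notation op R W := 'M[R[i]]_#|{: bits W}|.

Definition entry (R : realType) (W : finType) (M : op R W) (x y : bits W)
  : R[i] := M (enum_rank x) (enum_rank y).

Definition opmx (R : realType) (W : finType) (F : bits W -> bits W -> R[i])
  : op R W := \matrix_(i, j) F (enum_val i) (enum_val j).

Definition pull (V W : finType) (h : V -> W) (x : bits W) : bits V :=
  [ffun v => x (h v)].

(* X (x) Y on W, when the ranges of h1 and h2 partition W.                    *)
Definition tensor (R : realType) (V1 V2 W : finType) (h1 : V1 -> W)
    (h2 : V2 -> W) (X : op R V1) (Y : op R V2) : op R W :=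
  opmx (fun x y => entry X (pull h1 x) (pull h1 y) *
                   entry Y (pull h2 x) (pull h2 y)).

Definition tensor_power (R : realType) (t : nat) (W : finType) (M : op R W)
  : op R ('I_t * W)%type :=
  opmx (fun x y => \prod_(c < t) entry M (pull (pair c) x) (pull (pair c) y)).

Definition ket0 (R : realType) (W : finType) : op R W :=
  opmx (fun x y => ((x == [ffun=> false]) && (y == [ffun=> false]))%:R).

Definition join (V W : finType) (x : bits V) (z : bits W) : bits (V + W)%type :=
  [ffun v => match v with inl a => x a | inr b => z b end].

Definition ptrace (R : realType) (V W : finType) (M : op R (V + W)%type)
  : op R V :=
  opmx (fun x y => \sum_z entry M (join x z) (join y z)).

Definition psd (R : realType) (N : nat) (M : 'M[R[i]]_N) : Prop :=
  M^t* = M /\ forall v : 'rV[R[i]]_N, 0 <= (v *m M *m v^t*) 0 0.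

Definition density (R : realType) (N : nat) (M : 'M[R[i]]_N) : Prop :=
  psd M /\ \tr M = 1.

(* Meaningful for psd M, for which M = U^-1 * diag d * U with U unitary,      *)
(* U = spectralmx M and d = spectral_diag M.                                  *)
Definition sqrtmx (R : realType) (N : nat) (M : 'M[R[i]]_N) : 'M[R[i]]_N :=
  invmx (spectralmx M) *m diag_mx (map_mx sqrtC (spectral_diag M))
    *m spectralmx M.

Definition trnorm (R : realType) (N : nat) (M : 'M[R[i]]_N) : R :=
  complex.Re (\tr (sqrtmx (M^t* *m M))).

Definition S2 (R : realType) (N : nat) (rho : 'M[R[i]]_N) : R :=
  - ln (complex.Re (\tr (rho *m rho))).

(* A bipartition of n qubits is given by the set A of the qubits on its first *)
(* side, B being ~: A.                                                        *)

(* <x| rho^Gamma |y> = <x_A y_B| rho |y_A x_B>.                               *)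
Definition ptranspose (R : realType) (n : nat) (A : {set 'I_n})
    (rho : op R 'I_n) : op R 'I_n :=
  let mix (x y : bits 'I_n) : bits 'I_n :=
    [ffun q => if q \in A then x q else y q] in
  opmx (fun x y => entry rho (mix x y) (mix y x)).

Definition negativity (R : realType) (n : nat) (A : {set 'I_n})
    (rho : op R 'I_n) : R := ln (trnorm (ptranspose A rho)).

Definition fidelity (R : realType) (N : nat) (rho sigma : 'M[R[i]]_N) : R :=
  complex.Re (\tr (sqrtmx (sqrtmx rho *m sigma *m sqrtmx rho))) ^+ 2.

Definition side (n : nat) (A : {set 'I_n}) : finType := {q : 'I_n | q \in A}.

Definition separable (R : realType) (n : nat) (A : {set 'I_n})
    (sigma : op R 'I_n) : Prop :=
  exists (m : nat) (p : 'I_m -> R)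
         (X : 'I_m -> op R (side A)) (Y : 'I_m -> op R (side (~: A))),
  [/\ forall i, 0 <= p i, \sum_i p i = 1,
      forall i, density (X i) /\ density (Y i)
    & sigma = \sum_i (p i)%:C%C *:
                tensor (fun a : side A => val a)
                       (fun b : side (~: A) => val b) (X i) (Y i)].

(* Extended-real valued because - ln 0 = +oo; the library's real-valued ln is *)
(* 0 at 0.  The minimum is written as an infimum.                             *)
Definition fidelity_of_separability (R : realType) (n : nat) (A : {set 'I_n})
    (rho : op R 'I_n) : \bar R :=
  ereal_inf [set (- lne (fidelity rho sigma)%:E)%E
            | sigma in [set sigma | separable A sigma]].

(* Clifford+T; the Toffoli gate CCX is itself an exact Clifford+T circuit.    *)
(* The last argument of CX and CCX is the target.                             *)
Inductive gate (V : Type) : Type :=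
  | Had of V
  | T8 of V
  | CX of V & V
  | CCX of V & V & V.

Definition gate_wf (V : eqType) (g : gate V) : bool :=
  match g with
  | Had _ | T8 _ => true
  | CX c t => c != t
  | CCX c d t => uniq [:: c; d; t]
  end.

Definition flip (V : finType) (t : V) (b : bool) (y : bits V) : bits V :=
  [ffun v => if v == t then y v (+) b else y v].

(* Row x, column y holds <x| g |y>.                                           *)
Definition gate_mx (R : realType) (V : finType) (g : gate V) : op R V :=
  opmx (fun x y =>
    match g with
    | Had v => if [forall u, (u != v) ==> (x u == y u)]
               then (-1) ^+ (x v && y v) / sqrtC 2 else 0
    | T8 v => if x == y then (if x v then (1 + 'i) / sqrtC 2 else 1) else 0
    | CX c t => (x == flip t (y c) y)%:R
    | CCX c d t => (x == flip t (y c && y d) y)%:R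
    end).

Definition circuit_mx (R : realType) (V : finType) (C : seq (gate V))
  : op R V := foldl (fun U g => gate_mx R g *m U) 1%:M C.

(* A circuit on a register W uses additional wires 'I_a, initialised to 0.    *)
Definition run (R : realType) (W : finType) (a : nat)
    (C : seq (gate (W + 'I_a)%type)) (M : op R W) : op R (W + 'I_a)%type :=
  circuit_mx R C *m tensor inl inr M (ket0 R 'I_a) *m (circuit_mx R C)^t*.

(* Acceptance: the first ancilla is measured to be 1.                         *)
Definition accept_prob (R : realType) (W : finType) (a : nat)
    (C : seq (gate (W + 'I_a.+1)%type)) (M : op R W) : R :=
  complex.Re (\sum_(x : bits (W + 'I_a.+1)%type | x (inr ord0))
                 entry (run C M) x x).

(* Multi-stack machines, in the form of structured programs: each stack is a  *)
(* one-way infinite tape, so that two of them make a Turing machine tape, and *)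
(* every elementary operation or test costs one time unit.                    *)
Inductive cmd : Type :=
  | Skip
  | Push of bool & nat
  | Case of nat & cmd & cmd & cmd
  | Seq of cmd & cmd
  | While of nat & cmd.

Definition store := nat -> seq bool.

Definition upd (s : store) (i : nat) (u : seq bool) : store :=
  fun j => if j == i then u else s j.

(* exec c s T s': from s, the program c halts in s' after T steps.            *)
(* Case i ce cf ct pops stack i and branches on what was found: nothing,      *)
(* false or true.  While i c repeats c as long as stack i is nonempty.        *)
Inductive exec : cmd -> store -> nat -> store -> Prop :=
  | ExecSkip s : exec Skip s 1 s
  | ExecPush b i s : exec (Push b i) s 1 (upd s i (b :: s i))
  | ExecCaseE i ce cf ct s T s' :
      s i = [::] -> exec ce s T s' -> exec (Case i ce cf ct) s T.+1 s'
  | ExecCaseF i ce cf ct s u T s' :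
      s i = false :: u -> exec cf (upd s i u) T s' ->
      exec (Case i ce cf ct) s T.+1 s'
  | ExecCaseT i ce cf ct s u T s' :
      s i = true :: u -> exec ct (upd s i u) T s' ->
      exec (Case i ce cf ct) s T.+1 s'
  | ExecSeq c1 c2 s1 T1 s2 T2 s3 :
      exec c1 s1 T1 s2 -> exec c2 s2 T2 s3 -> exec (Seq c1 c2) s1 (T1 + T2) s3
  | ExecWhileE i c s : s i = [::] -> exec (While i c) s 1 s
  | ExecWhileN i c s1 T1 s2 T2 s3 :
      s1 i != [::] -> exec c s1 T1 s2 -> exec (While i c) s2 T2 s3 ->
      exec (While i c) s1 (T1 + T2).+1 s3.

(* The inputs are on the first stacks, the other stacks are empty, and the    *)
(* output is read on stack 0.                                                 *)
Definition outputs_within (P : cmd) (inputs : seq (seq bool)) (bound : nat)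
    (out : seq bool) : Prop :=
  exists (T : nat) (s : store),
    [/\ exec P (fun i => nth [::] inputs i) T s, (T <= bound)%N & s 0%N = out].

Definition bitstring (n : nat) (x : bits 'I_n) : seq bool :=
  [seq x i | i <- enum 'I_n].

Definition bipartition_string (n : nat) (A : {set 'I_n}) : seq bool :=
  bitstring [ffun q => q \in A].

Definition unary (m : nat) : seq bool := rcons (nseq m true) false.

(* num numbers the wires of W by 0, ..., #|W| - 1; the ancillas come next.    *)
Definition wire_string (W : finType) (num : W -> nat) (a : nat)
    (v : (W + 'I_a)%type) : seq bool :=
  unary (match v with inl w => num w | inr j => (#|W| + j)%N end).

Definition gate_string (W : finType) (num : W -> nat) (a : nat)
    (g : gate (W + 'I_a)%type) : seq bool :=
  let w := wire_string num in
  match g with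
  | Had v => [:: false; false] ++ w a v
  | T8 v => [:: false; true] ++ w a v
  | CX c t => [:: true; false] ++ w a c ++ w a t
  | CCX c d t => [:: true; true] ++ w a c ++ w a d ++ w a t
  end.

Definition circuit_string (W : finType) (num : W -> nat) (a : nat)
    (C : seq (gate (W + 'I_a)%type)) : seq bool :=
  unary a ++ flatten [seq gate_string num g | g <- C].

Definition copy_num (t n : nat) (w : 'I_t * 'I_n) : nat := (w.1 * n + w.2)%N.

(* {poly nat} plays the role of "poly(n)".                                    *)
Definition poly_bounded (h : nat -> nat) : Prop :=
  exists p : {poly nat}, forall n, (h n <= p.[n])%N.

(* P-uniformity.  The bipartition is part of the problem, so the program      *)
(* receives its n-bit indicator string (which also gives n) instead of 1^n.   *)
Definition polytime_algorithm (A : forall n, {set 'I_n}) (t : nat -> nat)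
    (a : nat -> nat)
    (C : forall n, seq (gate ('I_(t n) * 'I_n + 'I_(a n).+1)%type)) : Prop :=
  (forall n, all (@gate_wf _) (C n)) /\
  exists (P : cmd) (p : {poly nat}), forall n,
    outputs_within P [:: bipartition_string (A n)] p.[n]
      (circuit_string (@copy_num (t n) n) (C n)).

Definition ensemble (R : realType) (kappa : nat -> nat) : Type :=
  forall n, bits 'I_(kappa n) -> op R 'I_n.

(* Given k, a circuit computed in polynomial time from the bipartition and k  *)
(* prepares rho_k from the all-zero state, up to discarding ancillas.         *)
Definition efficiently_preparable (R : realType) (kappa : nat -> nat)
    (A : forall n, {set 'I_n}) (rho : ensemble R kappa) : Prop :=
  exists (a : forall n, bits 'I_(kappa n) -> nat)
         (C : forall n (k : bits 'I_(kappa n)),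
                seq (gate ('I_n + 'I_(a n k))%type)),
  [/\ forall n k, all (@gate_wf _) (C n k),
      exists (P : cmd) (p : {poly nat}), forall n k,
        outputs_within P [:: bipartition_string (A n); bitstring k] p.[n]
          (circuit_string (fun q : 'I_n => val q) (C n k))
    & forall n k, rho n k = ptrace (run (C n k) (ket0 R 'I_n))].

Definition prob_key (R : realType) (m : nat) (E : bits 'I_m -> Prop) : R :=
  #|[set k : bits 'I_m | `[< E k >]]|%:R / #|{: bits 'I_m}|%:R.

(* With probability >= 1 - 1/poly(n) over k, both measures are Theta(h(n));   *)
(* 1/poly(n) is the inverse of some nonconstant polynomial.                   *)
Definition entanglement_Theta (R : realType) (kappa : nat -> nat)
    (A : forall n, {set 'I_n}) (rho : ensemble R kappa) (h : nat -> R)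
  : Prop :=
  exists (c d : R) (p : {poly nat}),
  [/\ 0 < c, 0 < d, (1 < size p)%N
    & \forall n \near \oo,
        1 - (p.[n]%:R)^-1 <= prob_key R (fun k : bits 'I_(kappa n) =>
          [/\ c * h n <= negativity (A n) (rho n k) <= d * h n
            & ((c * h n)%:E <= fidelity_of_separability (A n) (rho n k)
                 <= (d * h n)%:E)%E])].

Definition mean_key (R : realType) (m : nat) (F : bits 'I_m -> R) : R :=
  (\sum_k F k) / #|{: bits 'I_m}|%:R.

Definition negligible (R : realType) (u : nat -> R) : Prop :=
  forall c : nat, \forall n \near \oo, `|u n| <= (n%:R ^+ c)^-1.

Definition indistinguishable (R : realType) (kappa : nat -> nat)
    (A : forall n, {set 'I_n}) (rho sigma : ensemble R kappa) : Prop :=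
  forall (t : {poly nat}) (a : nat -> nat)
         (C : forall n, seq (gate ('I_(t.[n]) * 'I_n + 'I_(a n).+1)%type)),
  polytime_algorithm A C ->
  negligible (fun n : nat =>
    `| mean_key (fun k => accept_prob (C n) (tensor_power t.[n] (rho n k)))
     - mean_key (fun k => accept_prob (C n) (tensor_power t.[n] (sigma n k))) |).

Record pseudoentangled (R : realType) (kappa : nat -> nat)
    (A : forall n, {set 'I_n}) (rho sigma : ensemble R kappa)
    (f g : nat -> R) : Prop := Pseudoentangled {
  pe_key_length : poly_bounded kappa;
  pe_density : forall n k, density (rho n k) /\ density (sigma n k);
  pe_preparable :
    efficiently_preparable A rho /\ efficiently_preparable A sigma;
  pe_entanglement :
    entanglement_Theta A rho f /\ entanglement_Theta A sigma g;
  pe_indistinguishable : indistinguishable A rho sigma }.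

Definition entropy_logarithmic (R : realType) (kappa : nat -> nat)
    (rho : ensemble R kappa) : Prop :=
  exists c : R, \forall n \near \oo, forall k, S2 (rho n k) <= c * ln n%:R.

(* Main.v *)
(* Write P for the purity tr (rho_A^2) of the reduced state on A.  In the     *)
(* form <v|rho^Gamma|w> three applications of Cauchy-Schwarz give the         *)
(* operator norm bound |rho^Gamma| <= sqrt P, whence                          *)
(* tr (rho^2) <= sqrt P * |rho^Gamma|_1: low negativity and low entropy force *)
(* P >= 1/poly.  Conversely, if a is a top eigenvector of rho_A and           *)
(* Pi = |a><a| (x) 1, the normalised state Pi rho Pi is separable and has     *)
(* fidelity at least tr (Pi rho) >= P with rho, so D_F <= - ln P: a large D_F *)
(* forces P <= 1/superpoly.  The swap test on the A sides of two copies has   *)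
(* outcome 1 with probability (1 - P)/2, and the majority of T = 2 n^C + 1    *)
(* such tests is 1 with probability at least (1 - T P)/2 in the second case   *)
(* and at most 1/(1 + n^C P^2) in the first.  Amplification by a majority is  *)
(* needed because the two ensembles may each have an inverse polynomial       *)
(* fraction of bad keys.  The bound f = O(n) comes from                       *)
(* 1 <= |rho^Gamma|_1 <= 2^(n/2).                                             *)
Require Import Defs.
From HB Require Import structures.
From mathcomp Require Import all_boot all_order all_algebra.
From mathcomp Require Import spectral.
From mathcomp Require Import complex.
From mathcomp Require Import all_classical all_reals all_analysis.
From mathcomp Require Import ring lra zify.

Set Implicit Arguments.
Unset Strict Implicit.
Unset Printing Implicit Defensive.

Import Order.TTheory GRing.Theory Num.Theory.
Import numFieldNormedType.Exports.

Local Open Scope classical_set_scope.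
Local Open Scope ring_scope.
Local Open Scope sesquilinear_scope.

(** * Hermitian matrices and the trace norm *)

(** Everything goes through the purity [P] of the state reduced to [A], which swap tests on pairs of
    copies reveal. Both entanglement measures control it. [purity_le_trnorm_ptranspose] turns low
    entropy and low negativity into [P >= n^(-b)] (see [side_purity_ge]); it rests on the operator
    norm bound [ptranspose_op_le]. Conversely [fidelity_of_separability_le] turns
    [D_F = omega(log n)] into [P <= n^(-C-1)] for every [C]; it uses the separable state obtained by
    projecting side [A] onto a top eigenvector of the reduced state ([separable_sigma],
    [fidelity_sigma_ge]).

    If [g = O(log n)] and [ln n = o(f)] held together, the two ensembles could be told apart. The
    circuit [tester] runs [T = 2 n^C + 1] swap tests on disjoint pairs of copies and outputs the
    majority; by [tester_accept] its acceptance probability is exactly [majority_prob] at [P]. On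
    good keys this is close to 1/2 or more for high entanglement ([majority_prob_ge]) and at most
    [1/n] for low entanglement ([majority_prob_le]). Bad keys cost about [1/n] in each mean
    ([tester_mean_high], [tester_mean_low]), so the means stay a constant apart.
    Indistinguishability only speaks of circuits generated in polynomial time, so [polytime_tester]
    exhibits a stack program that writes the description of [tester].

    The bound [f = O(n)] is separate: [entanglement_bounds] compares [f] with the negativity of a
    single good key. *)

Lemma cauchy_schwarz (C : numClosedFieldType) (I : finType) (a b : I -> C) :
  `|\sum_i a i * b i| ^+ 2 <= (\sum_i `|a i| ^+ 2) * (\sum_i `|b i| ^+ 2).
Proof.
apply: (@le_trans _ _ ((\sum_i `|a i| * `|b i|) ^+ 2)).
  have ge0 : 0 <= \sum_i `|a i| * `|b i|.
    by apply: sumr_ge0 => i _; exact: mulr_ge0.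
  rewrite ler_sqr ?nnegrE ?normr_ge0 //.
  by apply: le_trans (ler_norm_sum _ _ _) _; under eq_bigr do rewrite normrM.
rewrite -(ler_pM2l (ltr0Sn C 1)) -subr_ge0.
(* Lagrange's identity for the moduli; the factor 2 is there because ordered pairs count each pair
   twice. *)
have -> : 2 * ((\sum_i `|a i| ^+ 2) * (\sum_i `|b i| ^+ 2)) -
    2 * (\sum_i `|a i| * `|b i|) ^+ 2 =
    \sum_i \sum_j (`|a i| * `|b j| - `|a j| * `|b i|) ^+ 2.
  pose A i := `|a i|; pose B i := `|b i|.
  have -> : \sum_i \sum_j (A i * B j - A j * B i) ^+ 2 =
      \sum_i \sum_j (A i ^+ 2 * B j ^+ 2) + \sum_i \sum_j (B i ^+ 2 * A j ^+ 2)
      - 2 * \sum_i \sum_j (A i * B i) * (A j * B j).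
    rewrite mulr_sumr -big_split -sumrB; apply: eq_bigr => i _.
    rewrite mulr_sumr -big_split -sumrB; apply: eq_bigr => j _.
    by rewrite /=; ring.
  by rewrite -!big_distrlr /= -expr2 /A /B; ring.
apply: sumr_ge0 => i _; apply: sumr_ge0 => j _; exact: real_exprn_even_ge0.
Qed.

Lemma conjCM (C : numClosedFieldType) (x y : C) : (x * y)^* = x^* * y^*.
Proof. exact: rmorphM. Qed.

Lemma conjC_sum (C : numClosedFieldType) (I : finType) (F : I -> C) :
  (\sum_i F i)^* = \sum_i (F i)^*.
Proof. exact: rmorph_sum. Qed.

Section Adjoint.
Variable C : numClosedFieldType.

Lemma adjE m n (A : 'M[C]_(m, n)) i j : (A ^t*) i j = (A j i)^*.
Proof. by rewrite !mxE. Qed.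

Lemma adjM m n p (A : 'M[C]_(m, n)) (B : 'M[C]_(n, p)) :
  (A *m B)^t* = B ^t* *m A ^t*.
Proof. by rewrite trmx_mul map_mxM. Qed.

Lemma adjZ m n (c : C) (A : 'M[C]_(m, n)) : (c *: A)^t* = c^* *: A ^t*.
Proof. by apply/matrixP=> i j; rewrite !mxE rmorphM. Qed.

Lemma mul_adj_diag m n (A : 'M[C]_(m, n)) j :
  (A ^t* *m A) j j = \sum_i `|A i j| ^+ 2.
Proof. by rewrite mxE; apply: eq_bigr => i _; rewrite adjE normCK mulrC. Qed.

Lemma unitary_row_norm n (U : 'M[C]_n) i :
  U \is unitarymx -> \sum_j `|U i j| ^+ 2 = 1.
Proof.
move=> /unitarymxP/matrixP/(_ i i); rewrite !mxE eqxx mulr1n => <-.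
by apply: eq_bigr => j _; rewrite adjE normCK.
Qed.

Lemma mxtrace_unitary_conj n (U A : 'M[C]_n) :
  U \is unitarymx -> \tr (U *m A *m U^t*) = \tr A.
Proof.
by move=> uU; rewrite mxtrace_mulC mulmxA -(invmx_unitary uU) mulVmx
  ?mul1mx ?unitarymx_unit.
Qed.

Lemma hermitian_spectralE n (M : 'M[C]_n) : M ^t* = M ->
  M = (spectralmx M)^t* *m diag_mx (spectral_diag M) *m spectralmx M.
Proof.
move=> hM; rewrite -invmx_unitary ?spectral_unitarymx //.
by apply/orthomx_spectralP/normalmxP; rewrite hM.
Qed.

Lemma hermitian_spectral_diagE n (M : 'M[C]_n) : M ^t* = M ->
  spectralmx M *m M *m (spectralmx M)^t* = diag_mx (spectral_diag M).
Proof.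
move=> hM; rewrite {2}(hermitian_spectralE hM).
rewrite !mulmxA (unitarymxP (spectral_unitarymx M)) mul1mx.
by rewrite -mulmxA (unitarymxP (spectral_unitarymx M)) mulmx1.
Qed.

Lemma adj_mul_herm m n (T : 'M[C]_(m, n)) : (T ^t* *m T)^t* = T ^t* *m T.
Proof. by rewrite adjM trmxCK. Qed.

End Adjoint.

Lemma conj_real (R : rcfType) (x : R) : (x%:C%C)^* = x%:C%C :> R[i].
Proof. exact: conjc_real. Qed.

Section TraceNorm.
Variables (R : realType) (N : nat).
Implicit Types T M : 'M[R[i]]_N.

Definition singular_sq T i : R := complex.Re (spectral_diag (T ^t* *m T) 0 i).

Lemma singular_sqE T i :
  spectral_diag (T ^t* *m T) 0 i =
  \sum_j `|(T *m (spectralmx (T ^t* *m T))^t*) j i| ^+ 2.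
Proof.
have := hermitian_spectral_diagE (adj_mul_herm T).
set U := spectralmx _ => /matrixP/(_ i i); rewrite [RHS]mxE eqxx mulr1n => <-.
by rewrite -mul_adj_diag adjM trmxCK !mulmxA.
Qed.

Lemma singular_sq_ge0 T i : 0 <= singular_sq T i.
Proof.
rewrite -ler0c complexRe; have h : 0 <= spectral_diag (T ^t* *m T) 0 i.
  by rewrite singular_sqE; apply: sumr_ge0 => j _; apply: exprn_ge0.
by rewrite (Creal_ReP _ _) // ger0_real.
Qed.

Lemma singular_sqC T i : spectral_diag (T ^t* *m T) 0 i = (singular_sq T i)%:C%C.
Proof.
rewrite complexRe; apply/esym/Creal_ReP/ger0_real.
by rewrite singular_sqE; apply: sumr_ge0 => j _; apply: exprn_ge0.
Qed.

Lemma sqrtC_real (x : R) : 0 <= x -> sqrtC (x%:C)%C = (Num.sqrt x)%:C%C.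
Proof.
move=> x0; apply: (@pexpIrn _ 2) => //; rewrite ?nnegrE ?sqrtC_ge0 ?ler0c ?sqrtr_ge0 //.
by rewrite sqrtCK -rmorphXn sqr_sqrtr.
Qed.

Lemma sqr_sqrtr_real (x : R) : 0 <= x -> (Num.sqrt x)%:C%C ^+ 2 = (x%:C)%C.
Proof. by move=> x0; rewrite -rmorphXn sqr_sqrtr. Qed.

Lemma mxtrace_sqrtmx M :
  \tr (sqrtmx M) = \sum_i sqrtC (spectral_diag M 0 i).
Proof.
rewrite /sqrtmx mxtrace_mulC mulmxA mulmxV ?spectral_unit // mul1mx.
by rewrite mxtrace_diag; apply: eq_bigr => i _; rewrite mxE.
Qed.

Lemma trnormE T : trnorm T = \sum_i Num.sqrt (singular_sq T i).
Proof.
rewrite /trnorm mxtrace_sqrtmx -[RHS]/(complex.Re (_%:C)%C) rmorph_sum.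
congr complex.Re; apply: eq_bigr => i _.
by rewrite singular_sqC sqrtC_real // singular_sq_ge0.
Qed.

Lemma mxtrace_adj_mul T : \tr (T ^t* *m T) = (\sum_i singular_sq T i)%:C%C.
Proof.
rewrite -(mxtrace_unitary_conj _ (spectral_unitarymx (T ^t* *m T))).
rewrite hermitian_spectral_diagE ?adj_mul_herm // mxtrace_diag rmorph_sum.
by apply: eq_bigr => i _; rewrite singular_sqC.
Qed.

Lemma trnorm_ge0 T : 0 <= trnorm T.
Proof. by rewrite trnormE; apply: sumr_ge0 => i _; apply: sqrtr_ge0. Qed.

(* The diagonal of [U T U^*], [U] diagonalising [T^* T], is bounded by the    *)
(* singular values.                                                           *)
Lemma normr_mxtrace_le_trnorm T : `|\tr T| <= (trnorm T)%:C%C.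
Proof.
set U := spectralmx (T ^t* *m T).
rewrite -(mxtrace_unitary_conj T (spectral_unitarymx (T ^t* *m T))) -/U.
rewrite trnormE rmorph_sum; apply: le_trans (ler_norm_sum _ _ _) _.
apply: ler_sum => i _.
rewrite -ler_sqr ?nnegrE ?normr_ge0 ?ler0c ?sqrtr_ge0 //.
rewrite sqr_sqrtr_real ?singular_sq_ge0 // -singular_sqC singular_sqE -mulmxA mxE.
apply: le_trans (cauchy_schwarz _ _) _.
by rewrite unitary_row_norm ?mul1r ?spectral_unitarymx.
Qed.

(** Cauchy-Schwarz for the [N] singular values against the constant 1. *)
Lemma trnorm_sq_le T : trnorm T ^+ 2 <= N%:R * complex.Re (\tr (T ^t* *m T)).
Proof.
rewrite mxtrace_adj_mul trnormE /=.
have /= := cauchy_schwarz (fun _ : 'I_N => 1) (fun i => (Num.sqrt (singular_sq T i))%:C%C).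
under eq_bigr => i _ do rewrite mul1r.
rewrite -rmorph_sum ger0_norm; last first.
  by rewrite ler0c; apply: sumr_ge0 => i _; apply: sqrtr_ge0.
under [X in _ <= X * _]eq_bigr do rewrite normr1 expr1n.
under [X in _ <= _ * X]eq_bigr => i _ do
  rewrite ger0_norm ?ler0c ?sqrtr_ge0 // sqr_sqrtr_real ?singular_sq_ge0 //.
rewrite sumr_const card_ord -rmorph_sum -rmorphXn.
by rewrite -[X in X * _](rmorph_nat (real_complex R)) -rmorphM lecR.
Qed.

(** Hoelder's inequality between operator norm and trace norm. Each squared singular value [s] is
    the squared norm of the image of a unit eigenvector, so [s <= P]; then sum
    [s <= sqrt P * sqrt s]. *)
Lemma mxtrace_adj_mul_le T (P : R) : 0 <= P ->
  (forall v : 'rV[R[i]]_N, \sum_j `|(T *m v^t*) j 0| ^+ 2 <=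
     P%:C%C * \sum_j `|v 0 j| ^+ 2) ->
  complex.Re (\tr (T ^t* *m T)) <= Num.sqrt P * trnorm T.
Proof.
move=> P0 hT; rewrite mxtrace_adj_mul trnormE /= mulr_sumr.
apply: ler_sum => i _; set s := singular_sq T i.
have s0 : 0 <= s by apply: singular_sq_ge0.
have sP : s <= P.
  rewrite -lecR -singular_sqC singular_sqE.
  have := hT (row i (spectralmx (T ^t* *m T))).
  under [X in _ <= _ * X]eq_bigr do rewrite mxE.
  rewrite unitary_row_norm ?spectral_unitarymx // mulr1; apply: le_trans.
  rewrite le_eqVlt; apply/orP; left; apply/eqP; apply: eq_bigr => j _.
  by congr (`|_| ^+ 2); rewrite !mxE; apply: eq_bigr => k _; rewrite !mxE.
by rewrite -[leLHS]sqr_sqrtr // expr2 ler_wpM2r ?sqrtr_ge0 // ler_wsqrtr.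
Qed.

End TraceNorm.

(** * Spectra and purity of positive matrices *)

Section PositiveMatrices.
Variables (R : realType) (N : nat).
Implicit Types M : 'M[R[i]]_N.

Definition eigval M i : R := complex.Re (spectral_diag M 0 i).

Lemma spectral_diag_row M i : M ^t* = M ->
  spectral_diag M 0 i =
  (row i (spectralmx M) *m M *m (row i (spectralmx M))^t*) 0 0.
Proof.
move=> hM; have /matrixP/(_ i i) := hermitian_spectral_diagE hM.
rewrite [RHS]mxE eqxx mulr1n => <-.
by rewrite -row_mul !mxE; apply: eq_bigr => j _; rewrite !mxE.
Qed.

Lemma psd_spectral_diag_ge0 M i : psd M -> 0 <= spectral_diag M 0 i.
Proof. by case=> hM pM; rewrite spectral_diag_row. Qed.

Lemma eigvalE M i : psd M -> spectral_diag M 0 i = (eigval M i)%:C%C.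
Proof.
by move=> pM; rewrite complexRe; apply/esym/Creal_ReP/ger0_real/psd_spectral_diag_ge0.
Qed.

Lemma eigval_ge0 M i : psd M -> 0 <= eigval M i.
Proof. by move=> pM; rewrite -ler0c -eigvalE // psd_spectral_diag_ge0. Qed.

Lemma sqrtmx_hermitian M : psd M -> (sqrtmx M)^t* = sqrtmx M.
Proof.
move=> pM; rewrite /sqrtmx invmx_unitary ?spectral_unitarymx //.
rewrite !adjM trmxCK mulmxA; congr (_ *m _ *m _).
apply/matrixP => i j; rewrite !mxE; have [->|] := eqVneq i j; last first.
  by move=> _; rewrite !mulr0n conjC0.
rewrite !mulr1n; apply/CrealP/ger0_real.
by rewrite sqrtC_ge0 psd_spectral_diag_ge0.
Qed.

Lemma sqrtmx_sq M : psd M -> sqrtmx M *m sqrtmx M = M.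
Proof.
move=> pM; rewrite /sqrtmx !mulmxA mulmxK ?spectral_unit //.
rewrite -(mulmxA (invmx _)) mulmx_diag.
set d := (X in diag_mx X); have -> : d = spectral_diag M.
  by apply/rowP => i; rewrite !mxE -expr2 sqrtCK.
rewrite invmx_unitary ?spectral_unitarymx //.
exact/esym/hermitian_spectralE/pM.1.
Qed.

Lemma mxtrace_sq_eigval M : psd M ->
  \tr (M *m M) = (\sum_i eigval M i ^+ 2)%:C%C.
Proof.
move=> pM; have hM := pM.1.
rewrite -(mxtrace_unitary_conj _ (spectral_unitarymx M)).
set U := spectralmx M; have UU : U ^t* *m U = 1%:M.
  by rewrite -invmx_unitary ?spectral_unitarymx // mulVmx ?spectral_unit.
have -> : U *m (M *m M) *m U ^t* = (U *m M *m U^t*) *m (U *m M *m U^t*).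
  by rewrite -!mulmxA (mulmxA _ U) UU mul1mx.
rewrite hermitian_spectral_diagE // mulmx_diag mxtrace_diag rmorph_sum.
by apply: eq_bigr => i _; rewrite mxE eigvalE // -expr2 -rmorphXn.
Qed.

Lemma mxtrace_eigval M : psd M -> \tr M = (\sum_i eigval M i)%:C%C.
Proof.
move=> pM; rewrite -(mxtrace_unitary_conj _ (spectral_unitarymx M)).
rewrite hermitian_spectral_diagE ?pM.1 // mxtrace_diag rmorph_sum.
by apply: eq_bigr => i _; rewrite eigvalE.
Qed.

Lemma density_sum_eigval M : density M -> \sum_i eigval M i = 1.
Proof. by case=> pM; rewrite mxtrace_eigval // => /(congr1 (@complex.Re _)). Qed.

Lemma density_purityE M : density M ->
  complex.Re (\tr (M *m M)) = \sum_i eigval M i ^+ 2.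
Proof. by case=> pM _; rewrite mxtrace_sq_eigval. Qed.

Lemma density_purity_le1 M : density M -> complex.Re (\tr (M *m M)) <= 1.
Proof.
move=> dM; rewrite density_purityE // -(density_sum_eigval dM).
have e0 i : 0 <= eigval M i by apply: eigval_ge0; case: dM.
apply: ler_sum => i _; rewrite expr2 -[leRHS]mul1r ler_wpM2r //.
by rewrite -(density_sum_eigval dM) (bigD1 i) //= lerDl sumr_ge0.
Qed.

(** The purity is the average of the eigenvalues weighted by themselves, so some positive eigenvalue
    is at least as large; otherwise the weighted sum would be strictly below itself. *)
Lemma density_top_eigvec M : density M ->
  exists2 a : 'rV[R[i]]_N, \sum_j `|a 0 j| ^+ 2 = 1 &
  exists q : R, [/\ (a *m M *m a ^t*) 0 0 = q%:C%C, 0 < q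
    & complex.Re (\tr (M *m M)) <= q].
Proof.
move=> dM; have pM := dM.1; have e0 i := eigval_ge0 i pM.
pose P := \sum_i eigval M i ^+ 2.
suff [i [i0 iP]] : exists i, 0 < eigval M i /\ P <= eigval M i.
  exists (row i (spectralmx M)).
    by under eq_bigr do rewrite mxE; rewrite unitary_row_norm ?spectral_unitarymx.
  exists (eigval M i); split=> //; last by rewrite density_purityE.
  by rewrite -eigvalE // spectral_diag_row // pM.1.
apply: contrapT => noi.
have small i : 0 < eigval M i -> eigval M i < P.
  by move=> i0; rewrite ltNge; apply/negP => ?; apply: noi; exists i.
have [i i0] : exists i, 0 < eigval M i.
  apply: contrapT => noi'; have := density_sum_eigval dM.
  rewrite big1 => [/eqP|i _]; first by rewrite eq_sym oner_eq0.
  apply/eqP; rewrite eq_le e0 andbT leNgt; apply/negP => ?.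
  by apply: noi'; exists i.
have : P < P; last by rewrite ltxx.
rewrite -[X in _ < X]mulr1 -(density_sum_eigval dM) mulr_sumr {1}/P.
rewrite (bigD1 i) //= [ltRHS](bigD1 i) //=; apply: ltr_leD.
  by rewrite expr2 ltr_pM2r // small.
apply: ler_sum => j _; rewrite expr2; have := e0 j; rewrite le_eqVlt.
by case/orP => [/eqP<-|j0]; rewrite ?mulr0 // ler_pM2r // ltW // small.
Qed.

Lemma density_purity_gt0 M : density M -> 0 < complex.Re (\tr (M *m M)).
Proof.
move=> dM; rewrite density_purityE //; have e0 i := eigval_ge0 i dM.1.
have : \sum_i eigval M i ^+ 2 != 0.
  apply/eqP => /psumr_eq0P h; have := density_sum_eigval dM.
  rewrite big1 => [/eqP|i _]; first by rewrite eq_sym oner_eq0.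
  by apply/eqP; rewrite -sqrf_eq0 h // => j _; apply: sqr_ge0.
by rewrite lt0r => -> /=; apply: sumr_ge0 => i _; apply: sqr_ge0.
Qed.

End PositiveMatrices.

(** * Bipartite states *)

Section Entries.
Variables (R : realType).

Lemma entry_opmx (W : finType) (F : bits W -> bits W -> R[i]) x y :
  entry (opmx F) x y = F x y.
Proof. by rewrite /entry mxE !enum_rankK. Qed.

Lemma entry_ext (W : finType) (M M' : op R W) :
  (forall x y, entry M x y = entry M' x y) -> M = M'.
Proof.
move=> h; apply/matrixP => i j.
by rewrite -(enum_valK i) -(enum_valK j); exact: h.
Qed.

Lemma big_enum_rank (W : finType) (F : 'I_#|{: bits W}| -> R[i]) :
  \sum_i F i = \sum_(x : bits W) F (enum_rank x).
Proof.
by rewrite (reindex (@enum_rank _)) //; apply: onW_bij; exact: enum_rank_bij.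
Qed.

Lemma entry_mul (W : finType) (M M' : op R W) x y :
  entry (M *m M') x y = \sum_z entry M x z * entry M' z y.
Proof. by rewrite /entry mxE big_enum_rank. Qed.

Lemma entry_adj (W : finType) (M : op R W) x y :
  entry (M ^t*) x y = (entry M y x)^*.
Proof. by rewrite /entry adjE. Qed.

Lemma entry_scale (W : finType) (c : R[i]) (M : op R W) x y :
  entry (c *: M) x y = c * entry M x y.
Proof. by rewrite /entry mxE. Qed.

Lemma mxtrace_entry (W : finType) (M : op R W) : \tr M = \sum_x entry M x x.
Proof. by rewrite /mxtrace big_enum_rank. Qed.

Lemma mxtrace_hermitian_sq (W : finType) (M : op R W) : M ^t* = M ->
  \tr (M *m M) = \sum_x \sum_y `|entry M x y| ^+ 2.
Proof.
move=> hM; rewrite mxtrace_entry; apply: eq_bigr => x _.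
rewrite entry_mul; apply: eq_bigr => y _.
by rewrite -{2}hM entry_adj -normCK.
Qed.

Lemma quadratic_entry (W : finType) (M : op R W) (v : 'rV[R[i]]_#|{: bits W}|) :
  (v *m M *m v ^t*) 0 0 =
  \sum_x \sum_y v 0 (enum_rank x) * entry M x y * (v 0 (enum_rank y))^*.
Proof.
rewrite mxE big_enum_rank exchange_big /=; apply: eq_bigr => y _.
by rewrite mxE big_enum_rank adjE mulr_suml.
Qed.

Lemma psd_entryP (W : finType) (M : op R W) :
  psd M <-> (forall x y, entry M x y = (entry M y x)^*) /\
  (forall v : bits W -> R[i], 0 <= \sum_x \sum_y v x * entry M x y * (v y)^*).
Proof.
split=> [[hM pM]|[hM pM]]; split.
- by move=> x y; rewrite -{1}hM entry_adj.
- move=> v; have := pM (\row_i v (enum_val i)); rewrite quadratic_entry.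
  by under eq_bigr => x _ do under eq_bigr => y _ do rewrite !mxE !enum_rankK.
- by apply: entry_ext => x y; rewrite entry_adj -hM.
- by move=> v; rewrite quadratic_entry; exact: (pM (fun x => v 0 (enum_rank x))).
Qed.

End Entries.

Section Bipartition.
Variables (R : realType) (n : nat) (A : {set 'I_n}).

Local Notation C := R[i].
Local Notation bA := (bits (side A)).
Local Notation bB := (bits (side (~: A))).
Local Notation resA := (pull (fun a : side A => val a)).
Local Notation resB := (pull (fun b : side (~: A) => val b)).

(** The mixing used inside [ptranspose]; it also describes what exchanging the [A] sides of two
    copies does to their bit strings. *)
Definition mix (x y : bits 'I_n) : bits 'I_n :=
  [ffun q => if q \in A then x q else y q].

Definition joinAB (al : bA) (be : bB) : bits 'I_n :=
  [ffun q => if (insub q : option (side A)) is Some a then al a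
             else if (insub q : option (side (~: A))) is Some b then be b
             else false].

Lemma joinABK1 al be : resA (joinAB al be) = al.
Proof. by apply/ffunP => a; rewrite !ffunE valK. Qed.

Lemma joinABK2 al be : resB (joinAB al be) = be.
Proof.
apply/ffunP => b; rewrite !ffunE valK insubN //.
by have := valP b; rewrite inE.
Qed.

Lemma joinAB_in al be q (h : q \in A) : joinAB al be q = al (Sub q h).
Proof. by rewrite ffunE insubT. Qed.

Lemma joinAB_notin al be q (h : q \in ~: A) : joinAB al be q = be (Sub q h).
Proof. by rewrite ffunE insubN ?insubT //; move: h; rewrite inE. Qed.

Lemma resK x : joinAB (resA x) (resB x) = x.
Proof.
apply/ffunP => q; have [h|h] := boolP (q \in A); first by rewrite joinAB_in ffunE.
by have h' : q \in ~: A; [rewrite inE | rewrite joinAB_notin ffunE].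
Qed.

Lemma mix_joinAB al be al' be' : mix (joinAB al be) (joinAB al' be') = joinAB al be'.
Proof.
apply/ffunP => q; rewrite [LHS]ffunE; case: ifP => [h|h]; first by rewrite !joinAB_in.
by have h' : q \in ~: A; [rewrite inE h | rewrite !joinAB_notin].
Qed.

Lemma big_joinAB (F : bits 'I_n -> C) :
  \sum_x F x = \sum_al \sum_be F (joinAB al be).
Proof.
rewrite pair_big /= (reindex (fun p : bA * bB => joinAB p.1 p.2)) //=.
apply: onW_bij; exists (fun x => (resA x, resB x)) => [[al be]|x] /=.
  by rewrite joinABK1 joinABK2.
exact: resK.
Qed.

Definition rdm (rho : op R 'I_n) : op R (side A) :=
  opmx (fun al al' => \sum_be entry rho (joinAB al be) (joinAB al' be)).

Definition side_purity (rho : op R 'I_n) : R := complex.Re (\tr (rdm rho *m rdm rho)).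

Lemma density_rdm rho : density rho -> density (rdm rho).
Proof.
case=> /psd_entryP [hR pR] tR; split.
  apply/psd_entryP; split=> [x y|v].
    rewrite !entry_opmx rmorph_sum; apply: eq_bigr => be _; exact: hR.
  have -> : \sum_x \sum_y v x * entry (rdm rho) x y * (v y)^* =
    \sum_be \sum_al \sum_al' v al * entry rho (joinAB al be) (joinAB al' be) * (v al')^*.
    rewrite [RHS]exchange_big /=; apply: eq_bigr => al _.
    rewrite [RHS]exchange_big /=; apply: eq_bigr => al' _.
    by rewrite entry_opmx mulr_sumr mulr_suml.
  apply: sumr_ge0 => be _.
  (* The reduced form at [v] is the sum over [be] of the form of [rho] at [v] tensored with the
     basis vector [be]. *)
  have := pR (fun x => v (resA x) * (resB x == be)%:R).
  suff -> : \sum_x \sum_y v (resA x) * (resB x == be)%:R * entry rho x y *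
     (v (resA y) * (resB y == be)%:R)^* =
    \sum_al \sum_al' v al * entry rho (joinAB al be) (joinAB al' be) * (v al')^* by [].
  rewrite big_joinAB; apply: eq_bigr => al _.
  rewrite (bigD1 be) //= [X in _ + X]big1 ?addr0 => [|be' /negPf nbe]; last first.
    by rewrite big1 // => y _; rewrite joinABK2 nbe mulr0 !mul0r.
  rewrite big_joinAB; apply: eq_bigr => al' _.
  rewrite (bigD1 be) //= [X in _ + X]big1 ?addr0 => [|be' /negPf nbe]; last first.
    by rewrite !joinABK2 nbe mulr0 conjC0 mulr0.
  by rewrite !joinABK1 !joinABK2 !eqxx !mulr1.
rewrite mxtrace_entry -tR mxtrace_entry big_joinAB; apply: eq_bigr => al _.
by rewrite entry_opmx.
Qed.

Lemma side_purityC rho : density rho ->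
  (side_purity rho)%:C%C = \tr (rdm rho *m rdm rho).
Proof. by move=> /density_rdm[pR _]; rewrite /side_purity mxtrace_sq_eigval. Qed.

Lemma side_purity_le1 rho : density rho -> side_purity rho <= 1.
Proof. by move=> /density_rdm/density_purity_le1. Qed.

Lemma side_purity_gt0 rho : density rho -> 0 < side_purity rho.
Proof. by move=> /density_rdm/density_purity_gt0. Qed.

(** The swap trick: the purity is the expectation, in two copies of [rho], of the operator
    exchanging their [A] sides. *)
Lemma side_purity_mix rho : density rho -> (side_purity rho)%:C%C =
  \sum_u \sum_u' entry rho (mix u' u) u * entry rho (mix u u') u'.
Proof.
move=> dr; rewrite side_purityC // mxtrace_entry [RHS]big_joinAB exchange_big /=.
transitivity (\sum_al \sum_al' entry (rdm rho) al' al * entry (rdm rho) al al').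
  rewrite [RHS]exchange_big /=; apply: eq_bigr => al _.
  by rewrite entry_mul.
transitivity (\sum_al \sum_al' \sum_be \sum_be'
   entry rho (joinAB al' be) (joinAB al be) * entry rho (joinAB al be') (joinAB al' be')).
  apply: eq_bigr => al _; apply: eq_bigr => al' _.
  by rewrite !entry_opmx big_distrlr.
rewrite [RHS]exchange_big; apply: eq_bigr => al _ /=.
transitivity (\sum_be \sum_al' \sum_be'
   entry rho (joinAB al' be) (joinAB al be) * entry rho (joinAB al be') (joinAB al' be')).
  by rewrite exchange_big.
apply: eq_bigr => be _; rewrite [RHS]big_joinAB.
apply: eq_bigr => al' _; apply: eq_bigr => be' _.
by rewrite !mix_joinAB.
Qed.

End Bipartition.

(** * Norms of the partial transpose *)

Section PartialTranspose.
Variables (R : realType) (n : nat) (A : {set 'I_n}) (rho : op R 'I_n).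
Hypothesis drho : density rho.

Local Notation C := R[i].
Local Notation bA := (bits (side A)).
Local Notation bB := (bits (side (~: A))).
Local Notation B := (sqrtmx rho).
Local Notation Gamma := (ptranspose A rho).
Local Notation P := (side_purity A rho).

Lemma ptranspose_mix x y : entry Gamma x y = entry rho (mix A x y) (mix A y x).
Proof. by rewrite entry_opmx. Qed.

Lemma ptranspose_hermitian : Gamma ^t* = Gamma.
Proof.
have /psd_entryP[hR _] := drho.1.
by apply: entry_ext => x y; rewrite entry_adj !ptranspose_mix [RHS]hR.
Qed.

Lemma mxtrace_ptranspose : \tr Gamma = 1.
Proof.
rewrite -drho.2 !mxtrace_entry; apply: eq_bigr => x _; rewrite ptranspose_mix.
by have -> : mix A x x = x by apply/ffunP => q; rewrite ffunE if_same.
Qed.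

(** Partial transposition permutes the matrix entries, through the involution [f] on index pairs, so
    it preserves the Hilbert-Schmidt norm. *)
Lemma ptranspose_purity : \tr (Gamma ^t* *m Gamma) = \tr (rho *m rho).
Proof.
rewrite ptranspose_hermitian !mxtrace_hermitian_sq ?ptranspose_hermitian ?drho.1.1 //.
pose f (p : bits 'I_n * bits 'I_n) := (mix A p.1 p.2, mix A p.2 p.1).
have fK : involutive f.
  move=> [x y]; rewrite /f /=; congr (_, _); apply/ffunP => q; rewrite !ffunE;
  by case: (q \in A).
rewrite !pair_big /= [RHS](reindex_inj (inv_inj fK)) /=.
by apply: eq_bigr => -[x y] _; rewrite ptranspose_mix.
Qed.

Lemma entry_sqrt_decomp x y : entry rho x y = \sum_k entry B x k * (entry B y k)^*.
Proof.
rewrite -{1}(sqrtmx_sq drho.1) entry_mul; apply: eq_bigr => k _.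
by rewrite -entry_adj sqrtmx_hermitian //; exact: drho.1.
Qed.

(* [Q v = <v| rho_A (x) 1 |v>], up to complex conjugation.                    *)
Let Q (v : bits 'I_n -> C) : C := \sum_(al : bA) \sum_(al' : bA)
  entry (rdm A rho) al al' * \sum_(be : bB) (v (joinAB al be))^* * v (joinAB al' be).

Lemma rdm_form_sqnorm v : Q v = \sum_(p : bits 'I_n * (bB * bB))
  `|\sum_(al : bA) (v (joinAB al p.2.1))^* * entry B (joinAB al p.2.2) p.1| ^+ 2.
Proof.
rewrite -(pair_big xpredT xpredT (fun k (q : bB * bB) =>
   `|\sum_(al : bA) (v (joinAB al q.1))^* * entry B (joinAB al q.2) k| ^+ 2)) /=.
under [RHS]eq_bigr => k _ do rewrite -(pair_big xpredT xpredT (fun be be' : bB =>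
   `|\sum_(al : bA) (v (joinAB al be))^* * entry B (joinAB al be') k| ^+ 2)) /=.
transitivity (\sum_k \sum_(be : bB) \sum_(be' : bB) \sum_(al : bA) \sum_(al' : bA)
  ((v (joinAB al be))^* * v (joinAB al' be)) *
  (entry B (joinAB al be') k * (entry B (joinAB al' be') k)^*)); last first.
  apply: eq_bigr => k _; apply: eq_bigr => be _; apply: eq_bigr => be' _.
  rewrite normCK conjC_sum big_distrlr; apply: eq_bigr => al _.
  by apply: eq_bigr => al' _; rewrite conjCM conjCK /=; ring.
rewrite exchange_big /=; under [RHS]eq_bigr do rewrite exchange_big /=.
transitivity (\sum_(be : bB) \sum_(be' : bB) \sum_(al : bA) \sum_(al' : bA)
   ((v (joinAB al be))^* * v (joinAB al' be)) * entry rho (joinAB al be') (joinAB al' be')).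
  rewrite /Q; under [RHS]eq_bigr do rewrite exchange_big /=.
  rewrite [RHS]exchange_big; apply: eq_bigr => al _ /=.
  under [RHS]eq_bigr do rewrite exchange_big /=.
  rewrite [RHS]exchange_big; apply: eq_bigr => al' _ /=.
  rewrite entry_opmx mulrC big_distrlr /=; apply: eq_bigr => be _.
  by apply: eq_bigr.
apply: eq_bigr => be _; apply: eq_bigr => be' _.
rewrite [RHS]exchange_big; apply: eq_bigr => al _ /=.
rewrite [RHS]exchange_big; apply: eq_bigr => al' _ /=.
by rewrite entry_sqrt_decomp mulr_sumr.
Qed.

(** In [rho = B B^*], partial transposition exchanges the indices outside [A] of the two factors.
    Grouping [v] with one factor and [w] with the other makes the form a sum of products over
    [(k, be, be')]; Cauchy-Schwarz leaves the squared norms of [a] and [b], which are [Q v] and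
    [Q w] by [rdm_form_sqnorm]. *)
Lemma ptranspose_form_le v w :
  `|\sum_x \sum_y (v x)^* * entry Gamma x y * w y| ^+ 2 <= Q v * Q (fun x => w x).
Proof.
pose a (p : bits 'I_n * (bB * bB)) :=
  \sum_(al : bA) (v (joinAB al p.2.1))^* * entry B (joinAB al p.2.2) p.1.
pose b (p : bits 'I_n * (bB * bB)) :=
  \sum_(al : bA) (entry B (joinAB al p.2.1) p.1)^* * w (joinAB al p.2.2).
have -> : \sum_x \sum_y (v x)^* * entry Gamma x y * w y = \sum_p a p * b p.
  transitivity (\sum_k \sum_(be : bB) \sum_(be' : bB) \sum_(al : bA) \sum_(al' : bA)
     (v (joinAB al be))^* * entry B (joinAB al be') k *
     ((entry B (joinAB al' be) k)^* * w (joinAB al' be'))); last first.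
    rewrite -(pair_big xpredT xpredT (fun k (q : bB * bB) =>
       a (k, q) * b (k, q))) /=; apply: eq_bigr => k _.
    rewrite -(pair_big xpredT xpredT (fun be be' : bB =>
       a (k, (be, be')) * b (k, (be, be')))) /=; apply: eq_bigr => be _.
    by apply: eq_bigr => be' _; rewrite big_distrlr.
  rewrite [RHS]exchange_big /=; under [RHS]eq_bigr do rewrite exchange_big /=.
  rewrite (big_joinAB A) exchange_big /=; apply: eq_bigr => be _.
  under eq_bigr do rewrite (big_joinAB A) exchange_big /=.
  rewrite exchange_big; apply: eq_bigr => be' _ /=.
  rewrite [RHS]exchange_big; apply: eq_bigr => al _ /=.
  rewrite [RHS]exchange_big; apply: eq_bigr => al' _ /=.
  rewrite ptranspose_mix !mix_joinAB entry_sqrt_decomp mulr_sumr mulr_suml.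
  by apply: eq_bigr => k _; ring.
apply: le_trans (cauchy_schwarz _ _) _; rewrite !rdm_form_sqnorm.
rewrite le_eqVlt; apply/orP; left; apply/eqP; congr (_ * _).
rewrite (reindex_inj (_ : injective (fun p : bits 'I_n * (bB * bB) =>
   (p.1, (p.2.2, p.2.1))))) /=; last by move=> [k [x y]] [k' [x' y']] [-> -> ->].
apply: eq_bigr => -[k [be be']] _; rewrite /b /= -norm_conjC conjC_sum.
congr (`|_| ^+ 2); apply: eq_bigr => al _.
by rewrite conjCM conjCK mulrC.
Qed.

Lemma rdm_form_ge0 v : 0 <= Q v.
Proof. by rewrite rdm_form_sqnorm; apply: sumr_ge0 => p _; apply: exprn_ge0. Qed.

(** [Q v] pairs the reduced state, whose squared Hilbert-Schmidt norm is [P], with the Gram matrix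
    [G] of the slices of [v]. After Cauchy-Schwarz for this pairing, a further one bounds each entry
    of [G]. *)
Lemma rdm_form_sq_le v : Q v ^+ 2 <= P%:C%C * (\sum_x `|v x| ^+ 2) ^+ 2.
Proof.
pose G (p : bA * bA) := \sum_(be : bB) (v (joinAB p.1 be))^* * v (joinAB p.2 be).
have -> : Q v = \sum_(p : bA * bA) entry (rdm A rho) p.1 p.2 * G p.
  by rewrite /Q pair_big.
have -> : (\sum_(p : bA * bA) entry (rdm A rho) p.1 p.2 * G p) ^+ 2 =
   `|\sum_(p : bA * bA) entry (rdm A rho) p.1 p.2 * G p| ^+ 2.
  rewrite ger0_norm //; have := rdm_form_ge0 v.
  by rewrite /Q pair_big.
apply: le_trans (cauchy_schwarz _ _) _.
have dA := density_rdm A drho.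
have -> : \sum_(p : bA * bA) `|entry (rdm A rho) p.1 p.2| ^+ 2 = P%:C%C.
  by rewrite side_purityC // mxtrace_hermitian_sq ?dA.1.1 // pair_big.
rewrite ler_wpM2l ?ler0c ?(ltW (side_purity_gt0 _ _)) //.
rewrite (big_joinAB A) expr2 big_distrlr pair_big /=; apply: ler_sum => -[al al'] _.
apply: le_trans (cauchy_schwarz _ _) _ => /=.
by under eq_bigr do rewrite norm_conjC.
Qed.

Lemma ptranspose_op_le (u : 'rV[C]_#|{: bits 'I_n}|) :
  \sum_j `|(Gamma *m u ^t*) j 0| ^+ 2 <= P%:C%C * \sum_j `|u 0 j| ^+ 2.
Proof.
pose w x : C := (u 0 (enum_rank x))^*.
pose v x := \sum_y entry Gamma x y * w y.
have -> : \sum_j `|(Gamma *m u ^t*) j 0| ^+ 2 = \sum_x `|v x| ^+ 2.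
  rewrite big_enum_rank; apply: eq_bigr => x _; rewrite mxE big_enum_rank.
  by congr (`|_| ^+ 2); apply: eq_bigr => y _; rewrite adjE.
have -> : \sum_j `|u 0 j| ^+ 2 = \sum_x `|w x| ^+ 2.
  by rewrite big_enum_rank; apply: eq_bigr => x _; rewrite norm_conjC.
set V := \sum_x `|v x| ^+ 2; set W := \sum_x `|w x| ^+ 2.
have V0 : 0 <= V by apply: sumr_ge0 => x _; apply: exprn_ge0.
have W0 : 0 <= W by apply: sumr_ge0 => x _; apply: exprn_ge0.
have P0 : 0 <= P%:C%C :> C by rewrite ler0c ltW // side_purity_gt0.
have := ptranspose_form_le v w.
have -> : \sum_x \sum_y (v x)^* * entry Gamma x y * w y = V.
  apply: eq_bigr => x _; rewrite normCK mulrC {2}/v mulr_sumr.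
  by apply: eq_bigr => y _; rewrite mulrA.
rewrite ger0_norm // => h.
(* With [v = Gamma w] the form is [V] itself. Squaring once more lets [rdm_form_sq_le] apply to both
   factors, giving [V^4 <= (P V W)^2]; one [V] is cancelled below, the case [V = 0] apart. *)
have : (V ^+ 2) ^+ 2 <= (P%:C%C * V * W) ^+ 2.
  apply: (@le_trans _ _ ((Q v * Q w) ^+ 2)).
    by rewrite lerXn2r ?nnegrE ?exprn_ge0 ?mulr_ge0 ?rdm_form_ge0.
  have -> : (P%:C%C * V * W) ^+ 2 = (P%:C%C * V ^+ 2) * (P%:C%C * W ^+ 2) by ring.
  by rewrite exprMn ler_pM ?exprn_ge0 ?rdm_form_ge0 ?rdm_form_sq_le.
rewrite ler_sqr ?nnegrE ?exprn_ge0 ?mulr_ge0 // => h2.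
have := V0; rewrite le_eqVlt => /orP[/eqP<-|Vgt]; first by rewrite mulr_ge0.
by rewrite -(ler_pM2l Vgt); apply: le_trans h2 _; rewrite mulrCA mulrA.
Qed.

Lemma purity_le_trnorm_ptranspose :
  complex.Re (\tr (rho *m rho)) <= Num.sqrt P * trnorm Gamma.
Proof.
rewrite -ptranspose_purity; apply: mxtrace_adj_mul_le => [|v].
  exact/ltW/side_purity_gt0.
exact: ptranspose_op_le.
Qed.

Lemma trnorm_ptranspose_ge1 : 1 <= trnorm Gamma.
Proof.
by have := normr_mxtrace_le_trnorm Gamma; rewrite mxtrace_ptranspose normr1 -lecR.
Qed.

(** The dimension is [2^n], and the partial transpose has the same Hilbert-Schmidt norm as [rho], at
    most 1. *)
Lemma trnorm_ptranspose_sq_le : trnorm Gamma ^+ 2 <= 2 ^+ n.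
Proof.
apply: le_trans (trnorm_sq_le _) _; rewrite ptranspose_purity.
have N2 : #|{: bits 'I_n}|%:R = 2 ^+ n :> R.
  by rewrite card_ffun card_bool card_ord natrX.
by rewrite -N2 -[leRHS]mulr1 ler_wpM2l ?ler0n // density_purity_le1.
Qed.

End PartialTranspose.

(** * A separable state with large fidelity *)

Lemma adj_mul_sandwich (R : realType) N (B M : 'M[R[i]]_N) (c : R) :
    B ^t* = B -> M ^t* = M ->
  (c%:C%C *: (B *m M *m B))^t* *m (c%:C%C *: (B *m M *m B)) =
  (c ^+ 2)%:C%C *: (B *m M *m (B *m B) *m M *m B).
Proof.
move=> hB hM; rewrite adjZ !adjM hB hM conj_real.
by rewrite -scalemxAl -scalemxAr scalerA -rmorphM -expr2 !mulmxA.
Qed.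

Lemma mxtrace_sandwich (R : comPzRingType) N (B M : 'M[R]_N) :
  \tr (B *m M *m B) = \tr (M *m (B *m B)).
Proof. by rewrite -mulmxA mxtrace_mulC mulmxA. Qed.

Section SeparableApproximation.
Variables (R : realType) (n : nat) (A : {set 'I_n}) (rho : op R 'I_n).
Hypothesis drho : density rho.

Local Notation C := R[i].
Local Notation bA := (bits (side A)).
Local Notation bB := (bits (side (~: A))).
Local Notation resA := (pull (fun a : side A => val a)).
Local Notation resB := (pull (fun b : side (~: A) => val b)).
Local Notation B := (sqrtmx rho).
Local Notation P := (side_purity A rho).

Variables (a : bA -> C) (q : R).
Hypotheses (a1 : \sum_al `|a al| ^+ 2 = 1) (q0 : 0 < q).
Hypothesis aq : \sum_al \sum_al' a al * entry (rdm A rho) al al' * (a al')^* = q%:C%C.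

(* [|a^*><a^*| (x) 1]                                                         *)
Let Pi : op R 'I_n := opmx (fun x y =>
  (a (resA x))^* * a (resA y) * (resB x == resB y)%:R).

Let X : op R (side A) := opmx (fun al al' => (a al)^* * a al').

(** The state of the other side conditioned on the outcome [Pi], which has probability [q]. *)
Let Y : op R (side (~: A)) := opmx (fun be be' =>
  (q^-1)%:C%C * \sum_(al : bA) \sum_(al' : bA)
     a al * entry rho (joinAB al be) (joinAB al' be') * (a al')^*).

Let sigma : op R 'I_n := (q^-1)%:C%C *: (Pi *m rho *m Pi).

Lemma projector_hermitian : Pi ^t* = Pi.
Proof.
apply: entry_ext => x y; rewrite entry_adj !entry_opmx !conjCM conjCK.
by rewrite conjC_nat eq_sym (mulrC (a _)).
Qed.

Lemma entry_proj_l (M : op R 'I_n) al be y : entry (Pi *m M) (joinAB al be) y =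
  (a al)^* * \sum_(al' : bA) a al' * entry M (joinAB al' be) y.
Proof.
rewrite entry_mul (big_joinAB A) mulr_sumr; apply: eq_bigr => al' _.
rewrite (bigD1 be) //= [X in _ + X]big1 ?addr0 => [|be' /negPf nbe].
  by rewrite entry_opmx !joinABK1 !joinABK2 eqxx mulr1 mulrA.
by rewrite entry_opmx !joinABK2 eq_sym nbe mulr0 mul0r.
Qed.

Lemma entry_proj_r (M : op R 'I_n) x al be : entry (M *m Pi) x (joinAB al be) =
  (\sum_(al' : bA) entry M x (joinAB al' be) * (a al')^*) * a al.
Proof.
rewrite entry_mul (big_joinAB A) mulr_suml; apply: eq_bigr => al' _.
rewrite (bigD1 be) //= [X in _ + X]big1 ?addr0 => [|be' /negPf nbe].
  by rewrite entry_opmx !joinABK1 !joinABK2 eqxx mulr1 mulrA.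
by rewrite entry_opmx !joinABK2 nbe !mulr0.
Qed.

Lemma mxtrace_proj_rho : \tr (Pi *m rho) = q%:C%C.
Proof.
rewrite -aq mxtrace_entry (big_joinAB A).
under eq_bigr => al _ do under eq_bigr do rewrite entry_proj_l mulr_sumr.
under eq_bigr => al _ do rewrite exchange_big.
rewrite exchange_big; apply: eq_bigr => al _ /=; apply: eq_bigr => al' _.
by rewrite entry_opmx mulr_sumr mulr_suml; apply: eq_bigr => be _; ring.
Qed.

Lemma density_pure_side : density X.
Proof.
split; last first.
  rewrite mxtrace_entry -a1; apply: eq_bigr => al _.
  by rewrite entry_opmx normCK mulrC.
apply/psd_entryP; split=> [x y|v].
  by rewrite !entry_opmx conjCM conjCK mulrC.
have -> : \sum_x \sum_y v x * entry X x y * (v y)^* =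
   `|\sum_x v x * (a x)^*| ^+ 2.
  rewrite normCK conjC_sum big_distrlr /=; apply: eq_bigr => x _.
  by apply: eq_bigr => y _; rewrite entry_opmx conjCM conjCK; ring.
exact: exprn_ge0.
Qed.

Lemma density_other_side : density Y.
Proof.
have [hR pR] := (psd_entryP rho).1 drho.1.
have qC : 0 <= (q^-1)%:C%C :> C by rewrite ler0c invr_ge0 ltW.
split; last first.
  rewrite mxtrace_entry; under eq_bigr do rewrite entry_opmx.
  rewrite -mulr_sumr exchange_big /=; under eq_bigr do rewrite exchange_big /=.
  have -> : \sum_(al : bA) \sum_(al' : bA) \sum_(be : bB)
     a al * entry rho (joinAB al be) (joinAB al' be) * (a al')^* = q%:C%C.
    rewrite -aq; apply: eq_bigr => al _; apply: eq_bigr => al' _.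
    by rewrite entry_opmx mulr_sumr mulr_suml.
  by rewrite -rmorphM mulVf // gt_eqF.
apply/psd_entryP; split=> [x y|v].
  rewrite !entry_opmx conjCM conj_real; congr (_ * _).
  rewrite conjC_sum exchange_big; apply: eq_bigr => al _ /=.
  rewrite conjC_sum; apply: eq_bigr => al' _.
  by rewrite !conjCM conjCK -hR; ring.
have -> : \sum_x \sum_y v x * entry Y x y * (v y)^* =
  (q^-1)%:C%C * \sum_x \sum_y (a (resA x) * v (resB x)) * entry rho x y *
     (a (resA y) * v (resB y))^*; last by rewrite mulr_ge0.
rewrite (big_joinAB A) [in RHS]exchange_big mulr_sumr; apply: eq_bigr => be _ /=.
under [in RHS]eq_bigr do rewrite (big_joinAB A) exchange_big /=.
rewrite [in RHS]exchange_big mulr_sumr; apply: eq_bigr => be' _ /=.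
rewrite entry_opmx mulrCA -!mulrA; congr (_ * _).
rewrite mulr_suml mulr_sumr; apply: eq_bigr => al _ /=.
rewrite mulr_suml mulr_sumr; apply: eq_bigr => al' _ /=.
by rewrite !joinABK1 !joinABK2 conjCM; ring.
Qed.

(** Projecting side [A] onto a pure state leaves a product state, so a single term suffices. *)
Lemma separable_sigma : separable A sigma.
Proof.
exists 1%N, (fun=> 1), (fun=> X), (fun=> Y); split=> //.
- by rewrite big_ord1.
- by move=> _; split; [exact: density_pure_side | exact: density_other_side].
rewrite big_ord1 scale1r; apply: entry_ext => x y.
rewrite -(resK A x) -(resK A y) entry_scale entry_proj_r !entry_opmx.
rewrite !joinABK1 !joinABK2.
under eq_bigr do rewrite entry_proj_l -mulrA mulr_suml.
rewrite exchange_big /=.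
rewrite mulr_suml !mulr_sumr.
under [RHS]eq_bigr do rewrite !mulr_sumr.
apply: eq_bigr => al _; rewrite !mulr_sumr mulr_suml mulr_sumr.
by apply: eq_bigr => al' _; ring.
Qed.

(* With [T = sqrt rho Pi sqrt rho / sqrt q], [sqrt rho sigma sqrt rho = T^* T] *)
(* and [tr T = sqrt q].                                                       *)
Lemma fidelity_sigma_ge : q <= fidelity rho sigma.
Proof.
pose T := (Num.sqrt q)^-1%:C%C *: (B *m Pi *m B).
have hB := sqrtmx_hermitian drho.1.
have TT : B *m sigma *m B = T ^t* *m T.
  rewrite /T adj_mul_sandwich ?hB ?projector_hermitian ?(sqrtmx_sq drho.1) //.
  by rewrite exprVn sqr_sqrtr ?ltW // /sigma -scalemxAr -scalemxAl !mulmxA.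
have trT : \tr T = (Num.sqrt q)%:C%C.
  rewrite /T mxtraceZ mxtrace_sandwich (sqrtmx_sq drho.1).
  rewrite mxtrace_proj_rho -rmorphM; congr (_%:C)%C.
  rewrite -{2}[q]sqr_sqrtr ?ltW // expr2 mulrA mulVf ?mul1r //.
  by rewrite gt_eqF // sqrtr_gt0.
rewrite /fidelity TT -/(trnorm T) -[leLHS](sqr_sqrtr (ltW q0)).
rewrite ler_sqr ?nnegrE ?sqrtr_ge0 ?trnorm_ge0 //.
have := normr_mxtrace_le_trnorm T.
by rewrite trT ger0_norm ?ler0c ?sqrtr_ge0 // lecR.
Qed.

End SeparableApproximation.

Lemma fidelity_of_separability_le (R : realType) (n : nat) (A : {set 'I_n})
    (rho : op R 'I_n) : density rho ->
  (fidelity_of_separability A rho <= (- ln (side_purity A rho))%:E)%E.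
Proof.
move=> drho; have [a a1 [q [aq q0 Pq]]] := density_top_eigvec (density_rdm A drho).
rewrite big_enum_rank in a1; rewrite quadratic_entry in aq.
set al := fun x => a 0 (enum_rank x) in a1 aq.
set P := side_purity A rho; have P0 : 0 < P by apply: side_purity_gt0.
have fid := fidelity_sigma_ge drho q0 aq.
apply: ge_ereal_inf; eexists.
  by eexists; first exact: (separable_sigma drho a1 q0 aq).
(* A positive fidelity puts [lne] in its finite range. *)
have f0 := lt_le_trans q0 fid.
rewrite lne_EFin // -EFinN lee_fin lerN2 ler_ln //.
exact: le_trans Pq fid.
Qed.

(** * Circuits *)

Section ClassicalCircuits.
Variables (R : realType) (V : finType).
Implicit Types (g : gate V) (C : seq (gate V)) (x y : bits V).

Definition classical g : bool :=
  match g with Had _ | T8 _ => false | _ => true end.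

(** Non-classical gates get the identity, which keeps every well-formed action invertible in
    [cacts_inj]. *)
Definition cact g y : bits V :=
  match g with
  | Had _ | T8 _ => y
  | CX c t => flip t (y c) y
  | CCX c d t => flip t (y c && y d) y
  end.

Definition cacts C y : bits V := foldl (fun z g => cact g z) y C.

Lemma cacts_cat C1 C2 y : cacts (C1 ++ C2) y = cacts C2 (cacts C1 y).
Proof. by rewrite /cacts foldl_cat. Qed.

Lemma circuit_mx_rcons C g : circuit_mx R (rcons C g) = gate_mx R g *m circuit_mx R C.
Proof. by rewrite /circuit_mx foldl_rcons. Qed.

Lemma circuit_mx_cat C1 C2 : circuit_mx R (C1 ++ C2) = circuit_mx R C2 *m circuit_mx R C1.
Proof.
elim/last_ind: C2 => [|C2 g IH]; first by rewrite cats0 /circuit_mx mul1mx.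
by rewrite -rcons_cat !circuit_mx_rcons IH mulmxA.
Qed.

Lemma entry1 x y : entry (1%:M : op R V) x y = (x == y)%:R.
Proof. by rewrite /entry mxE (inj_eq enum_rank_inj). Qed.

Lemma entry_classical C x y : all classical C ->
  entry (circuit_mx R C) x y = (x == cacts C y)%:R.
Proof.
elim/last_ind: C x => [|C g IH] x; first by rewrite entry1.
rewrite all_rcons circuit_mx_rcons => /andP[cg cC].
rewrite entry_mul (bigD1 (cacts C y)) //= IH // eqxx mulr1 big1 ?addr0.
  rewrite /cacts foldl_rcons -/(cacts C y).
  by case: g cg => // *; rewrite entry_opmx.
by move=> z /negPf nz; rewrite IH // nz mulr0.
Qed.

Lemma flipE t b y v : flip t b y v = if v == t then y v (+) b else y v.
Proof. by rewrite ffunE. Qed.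

Lemma cactK g : gate_wf g -> involutive (cact g).
Proof.
case: g => //= [c t|c d t] wf y; apply/ffunP => v; rewrite !flipE.
  rewrite (negPf wf); case: eqVneq => [_|//]; by rewrite -addbA addbb addbF.
move: wf; rewrite !inE negb_or => /and3P[/andP[_ ct] dt _].
by rewrite (negPf ct) (negPf dt); case: eqVneq => [_|//]; rewrite -addbA addbb addbF.
Qed.

Lemma cacts_inj C : all (@gate_wf _) C -> injective (cacts C).
Proof.
elim: C => [_ x y //|g C IH /andP[wg wC] x y h].
exact: (can_inj (cactK wg)) (IH wC _ _ h).
Qed.

Lemma entry_Had_layer (s : seq V) x y : uniq s ->
  entry (circuit_mx R [seq Had v | v <- s]) x y =
  if [forall u, (u \notin s) ==> (x u == y u)]
  then \prod_(v <- s) ((-1) ^+ (x v && y v) / sqrtC 2) else 0.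
Proof.
elim/last_ind: s x => [|s v IH] x.
  rewrite entry1 big_nil => _; case: forallP => [h|h].
    by have -> : x = y; [apply/ffunP => u; apply/eqP; exact: h | rewrite eqxx].
  by case: eqVneq => // xy; case: h => u; rewrite xy eqxx.
rewrite map_rcons circuit_mx_rcons rcons_uniq entry_mul => /andP[vs us].
(* The only intermediate string that contributes: the last Hadamard changes wire [v] alone, and the
   earlier ones leave [v] as in [y]. *)
pose z : bits V := [ffun u => if u == v then y v else x u].
have zv : z v = y v by rewrite ffunE eqxx.
have zE u : u != v -> z u = x u by rewrite ffunE => /negPf->.
rewrite (bigD1 z) //= [X in _ + X]big1 ?addr0; last first.
  move=> z' z'z; rewrite IH // entry_opmx.
  case: ifP => [/forallP h1|]; last by rewrite mul0r.
  case: ifP => [/forallP h2|]; last by rewrite mulr0.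
  case/eqP: z'z; apply/ffunP => u; rewrite ffunE; case: eqVneq => [->|uv].
    by have := h2 v; rewrite vs => /eqP.
  by apply/esym/eqP; have := h1 u; rewrite uv.
rewrite IH // entry_opmx ifT; last first.
  by apply/forallP => u; apply/implyP => uv; rewrite zE.
have -> : [forall u, (u \notin s) ==> (z u == y u)] =
          [forall u, (u \notin rcons s v) ==> (x u == y u)].
  apply: eq_forallb => u; rewrite mem_rcons inE negb_or.
  by have [->|uv] := eqVneq u v; rewrite ?vs ?zv ?eqxx //= zE.
case: ifP => _; last by rewrite mulr0.
rewrite -cats1 big_cat big_seq1 zv mulrC; congr (_ * _).
rewrite big_seq [RHS]big_seq; apply: eq_bigr => u us'.
by rewrite zE //; apply: contraNneq vs => <-.
Qed.

End ClassicalCircuits.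

Lemma join_inl (V W : finType) (x : bits V) (z : bits W) v : join x z (inl v) = x v.
Proof. by rewrite ffunE. Qed.

Lemma join_inr (V W : finType) (x : bits V) (z : bits W) w : join x z (inr w) = z w.
Proof. by rewrite ffunE. Qed.

Lemma pullE (V W : finType) (h : V -> W) x v : pull h x v = x (h v).
Proof. by rewrite ffunE. Qed.

Lemma pull_inl_join (V W : finType) (x : bits V) (z : bits W) : pull inl (join x z) = x.
Proof. by apply/ffunP => v; rewrite pullE join_inl. Qed.

Lemma pull_inr_join (V W : finType) (x : bits V) (z : bits W) : pull inr (join x z) = z.
Proof. by apply/ffunP => v; rewrite pullE join_inr. Qed.

Lemma big_join (R : realType) (V W : finType) (F : bits (V + W)%type -> R[i]) :
  \sum_x F x = \sum_x \sum_z F (join x z).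
Proof.
rewrite pair_big /= (reindex (fun p : bits V * bits W => join p.1 p.2)) //=.
apply: onW_bij; exists (fun x => (pull inl x, pull inr x)) => [[x z]|x] /=.
  by rewrite pull_inl_join pull_inr_join.
by apply/ffunP => -[v|v]; rewrite !ffunE.
Qed.

(** * Acceptance probability of parallel Hadamard tests *)

Section HadamardTests.
Variables (R : realType) (W : finType) (a T : nat) (xs : 'I_T -> 'I_a.+1).
Hypothesis xs_inj : injective xs.
Local Notation V := (W + 'I_a.+1)%type.
Variables (C1 C2 : seq (gate V)).
Hypotheses (cl1 : all (@classical V) C1) (cl2 : all (@classical V) C2).
Hypothesis (wf2 : all (@gate_wf _) C2).

Definition emb (s : bits 'I_T) : bits 'I_a.+1 :=
  [ffun j => [exists i, (xs i == j) && s i]].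

Definition Had_layer : seq (gate V) := [seq Had (inr (xs i)) | i <- enum 'I_T].

Variables (pi : bits 'I_T -> bits W -> bits W) (out : pred (bits 'I_T)).
Hypothesis piK : forall s, involutive (pi s).
Hypothesis C1E : forall w s, cacts C1 (join w (emb s)) = join (pi s w) (emb s).
Hypothesis C2E : forall w s, cacts C2 (join w (emb s)) (inr ord0) = out s.

Definition Had_sign (y s : bits 'I_T) : R[i] := \prod_i (-1) ^+ (y i && s i).

Lemma emb_xs s i : emb s (xs i) = s i.
Proof.
rewrite ffunE; apply/existsP/idP => [[i' /andP[/eqP/xs_inj-> //]]|si].
by exists i; rewrite eqxx.
Qed.

Lemma embK s : pull xs (emb s) = s.
Proof. by apply/ffunP => i; rewrite ffunE emb_xs. Qed.

Lemma emb_notin s j : j \notin codom xs -> emb s j = false.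
Proof.
move=> h; rewrite ffunE; apply/existsP => -[i /andP[/eqP e _]].
by rewrite -e codom_f in h.
Qed.

Lemma emb0 : emb [ffun=> false] = [ffun=> false].
Proof.
by apply/ffunP => j; rewrite !ffunE; apply/existsP => -[k]; rewrite ffunE andbF.
Qed.

Lemma big_emb (F : bits 'I_a.+1 -> R[i]) :
  (forall z, z != emb (pull xs z) -> F z = 0) -> \sum_z F z = \sum_s F (emb s).
Proof.
move=> h; rewrite (bigID (fun z => z == emb (pull xs z))) /=.
rewrite [X in _ + X]big1 ?addr0; last by move=> z /h.
rewrite (reindex_onto emb (pull xs)) /=; last by move=> z /eqP.
by apply: eq_bigl => s; rewrite embK !eqxx.
Qed.

Lemma entry_Had_layer_emb w w' z s :
  entry (circuit_mx R Had_layer) (join w z) (join w' (emb s)) =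
  ((w == w') && (z == emb (pull xs z)))%:R * Had_sign (pull xs z) s * (sqrtC 2 ^- T).
Proof.
have -> : Had_layer = [seq Had v | v <- [seq inr (xs i) | i <- enum 'I_T]].
  by rewrite -map_comp.
rewrite entry_Had_layer; last first.
  by rewrite map_inj_uniq ?enum_uniq // => i i' [/xs_inj].
have -> : [forall u, (u \notin [seq inr (xs i) | i <- enum 'I_T]) ==>
     (join w z u == join w' (emb s) u)] = (w == w') && (z == emb (pull xs z)).
  apply/forallP/andP => [h|[/eqP<- /eqP zE]].
    split; apply/eqP/ffunP; [move=> v | move=> j].
      have := h (inl v); rewrite !join_inl => /implyP/(_ _)/eqP; apply.
      by apply/mapP => -[].
    have [/codomP[i ->]|nj] := boolP (j \in codom xs).
      by rewrite emb_xs pullE.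
    have := h (inr j); rewrite !join_inr (emb_notin _ nj) => /implyP.
    move=> /(_ _)/eqP; rewrite emb_notin //; apply.
    by apply: contra nj => /mapP[i _ [->]]; exact: codom_f.
  case=> [v|j]; first by rewrite !join_inl eqxx implybT.
  rewrite !join_inr; apply/implyP => nj; rewrite zE !emb_notin //;
  apply: contra nj => /codomP[i ->];
  by apply/mapP; exists i; rewrite ?mem_enum.
case: ifP => _; last by rewrite !mul0r.
rewrite mul1r big_map big_enum /= big_split /=; congr (_ * _).
  by apply: eq_bigr => i _; rewrite !join_inr emb_xs pullE.
by rewrite prodr_const card_ord exprVn.
Qed.

(** The first layer spreads the zero controls uniformly over [s], and the second contributes the
    signs; their normalisations combine into [2 ^- T]. *)
Lemma entry_Had_tests w w' z :
  entry (circuit_mx R (Had_layer ++ C1 ++ Had_layer)) (join w z)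
     (join w' [ffun=> false]) =
  (z == emb (pull xs z))%:R * (2 ^- T) *
  \sum_s (w == pi s w')%:R * Had_sign (pull xs z) s.
Proof.
rewrite !circuit_mx_cat entry_mul big_join.
have r2 : (sqrtC 2 ^- T) * (sqrtC 2 ^- T) = 2 ^- T :> R[i].
  by rewrite -invfM -exprMn -expr2 sqrtCK.
rewrite (bigD1 w') //= [X in _ + X]big1 ?addr0; last first.
  move=> w2 /negPf nw; rewrite big1 // => z2 _.
  by rewrite -emb0 entry_Had_layer_emb nw !mul0r mulr0.
rewrite big_emb; last first.
  by move=> z2 /negPf nz; rewrite -emb0 entry_Had_layer_emb nz andbF !mul0r ?mulr0.
rewrite mulr_sumr; apply: eq_bigr => s _.
rewrite -emb0 entry_Had_layer_emb embK !eqxx mul1r.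
have -> : Had_sign s [ffun=> false] = 1.
  by rewrite /Had_sign big1 // => i _; rewrite ffunE andbF.
rewrite mul1r entry_mul (bigD1 (join (pi s w') (emb s))) //= big1 ?addr0; last first.
  by move=> u /negPf nu; rewrite (entry_classical _ _ _ cl1) C1E nu mulr0.
rewrite (entry_classical _ _ _ cl1) C1E eqxx mulr1 entry_Had_layer_emb -r2.
by case: eqVneq => _; case: eqVneq => _ /=; ring.
Qed.

(** [C2] permutes the basis, so measuring after it amounts to measuring the controls and evaluating
    [out] on the outcome [y]. Control strings [s] and [s'] interfere, each amplitude carrying
    [2 ^- T]. *)
Lemma accept_prob_tests (M : op R W) :
  accept_prob (Had_layer ++ C1 ++ Had_layer ++ C2) M = complex.Re
   (\sum_(y | out y) 4 ^- T * \sum_s \sum_s' Had_sign y s * Had_sign y s' *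
       \sum_w entry M (pi s w) (pi s' w)).
Proof.
rewrite /accept_prob /run; congr complex.Re.
rewrite !catA circuit_mx_cat; set U := circuit_mx R (_ ++ _); set U2 := circuit_mx R C2.
set M0 := tensor _ _ _ _; set N := U *m M0 *m U ^t*.
have -> : U2 *m U *m M0 *m (U2 *m U)^t* = U2 *m N *m U2 ^t*.
  by rewrite adjM /N !mulmxA.
have -> : \sum_(x : bits V | x (inr ord0)) entry (U2 *m N *m U2 ^t*) x x =
   \sum_(x : bits V | cacts C2 x (inr ord0)) entry N x x.
  rewrite (reindex_inj (cacts_inj wf2)) /=; apply: eq_bigr => x _.
  rewrite entry_mul (bigD1 x) //= [X in _ + X]big1 ?addr0; last first.
    move=> u /negPf nu; rewrite entry_adj (entry_classical _ _ _ cl2).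
    by rewrite (inj_eq (cacts_inj wf2)) eq_sym nu conjC0 mulr0.
  rewrite entry_adj (entry_classical _ _ _ cl2) eqxx conjC1 mulr1.
  rewrite entry_mul (bigD1 x) //= [X in _ + X]big1 ?addr0; last first.
    move=> u /negPf nu; rewrite (entry_classical _ _ _ cl2).
    by rewrite (inj_eq (cacts_inj wf2)) eq_sym nu mul0r.
  by rewrite (entry_classical _ _ _ cl2) eqxx mul1r.
have invE s w w1 : (w == pi s w1) = (w1 == pi s w).
  by apply/eqP/eqP => ->; rewrite piK.
have NE w z : entry N (join w z) (join w z) =
    (z == emb (pull xs z))%:R * (4 ^- T * \sum_s \sum_s'
      Had_sign (pull xs z) s * Had_sign (pull xs z) s' * entry M (pi s w) (pi s' w)).
  have -> : entry N (join w z) (join w z) = \sum_w1 \sum_w2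
     entry U (join w z) (join w1 [ffun=> false]) * entry M w1 w2 *
     (entry U (join w z) (join w2 [ffun=> false]))^*.
    rewrite /N -mulmxA entry_mul big_join; apply: eq_bigr => w1 _.
    rewrite (bigD1 [ffun=> false]) //= [X in _ + X]big1 ?addr0; last first.
      move=> z1 /negPf nz1; rewrite entry_mul big1 ?mulr0 // => u _.
      rewrite !entry_opmx.
      by rewrite pull_inr_join nz1 mulr0 mul0r.
    rewrite entry_mul mulr_sumr big_join; apply: eq_bigr => w2 _.
    rewrite (bigD1 [ffun=> false]) //= [X in _ + X]big1 ?addr0; last first.
      move=> z1 /negPf nz1; rewrite !entry_opmx.
      by rewrite !pull_inr_join nz1 andbF mulr0 mul0r mulr0.
    rewrite entry_adj !entry_opmx.
    by rewrite !pull_inl_join !pull_inr_join !eqxx mulr1 mulrA.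
  set y := pull xs z; set e := (z == emb y).
  transitivity (\sum_s \sum_s' \sum_w1 \sum_w2
     e%:R * 4 ^- T * (Had_sign y s * Had_sign y s' * ((w == pi s w1)%:R *
       ((w == pi s' w2)%:R * entry M w1 w2)))); last first.
    rewrite mulrA mulr_sumr; apply: eq_bigr => s _.
    rewrite mulr_sumr; apply: eq_bigr => s' _.
    rewrite (bigD1 (pi s w)) //= [X in _ + X]big1 ?addr0; last first.
      move=> w1 nw1; rewrite big1 // => w2 _.
      by rewrite invE (negPf nw1) mul0r !mulr0.
    rewrite (bigD1 (pi s' w)) //= [X in _ + X]big1 ?addr0; last first.
      by move=> w2 nw2; rewrite (invE s') (negPf nw2) mul0r !mulr0.
    by rewrite !piK !eqxx !mul1r.
  under [RHS]eq_bigr do rewrite exchange_big /=.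
  rewrite [RHS]exchange_big /=; apply: eq_bigr => w1 _.
  under [RHS]eq_bigr do rewrite exchange_big /=.
  rewrite [RHS]exchange_big /=; apply: eq_bigr => w2 _.
  rewrite /U -catA !entry_Had_tests -/y -/e.
  have conjH s : (Had_sign y s)^* = Had_sign y s.
    rewrite /Had_sign; apply/CrealP; apply: rpred_prod => i _.
    by rewrite rpredX // rpredN rpred1.
  rewrite !conjCM conjC_nat conjC_sum.
  have -> : (2 ^- T)^* = 2 ^- T :> R[i].
    by apply/CrealP; rewrite rpredV rpredX // rpredMn // rpred1.
  have -> : 4 ^- T = 2 ^- T * 2 ^- T :> R[i].
    by rewrite -invfM -exprMn; congr (_ ^- T); rewrite -natrM.
  rewrite -[(e%:R / _ * _) * entry _ _ _]mulrA mulrACA.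
  rewrite mulr_suml big_distrlr mulr_sumr; apply: eq_bigr => s _ /=.
  rewrite mulr_sumr; apply: eq_bigr => s' _.
  by rewrite conjCM conjC_nat conjH [e%:R / _ * _]mulrACA -natrM mulnb andbb; ring.
rewrite big_mkcond big_join /=.
transitivity (\sum_w \sum_(y | out y) (4 ^- T * \sum_s \sum_s'
      Had_sign y s * Had_sign y s' * entry M (pi s w) (pi s' w)) : R[i]).
  apply: eq_bigr => w _; rewrite big_emb; last first.
    by move=> z /negPf nz; rewrite NE nz mul0r if_same.
  rewrite [RHS]big_mkcond; apply: eq_bigr => y _.
  by rewrite C2E NE embK eqxx mul1r.
rewrite exchange_big; apply: eq_bigr => y _ /=.
rewrite -mulr_sumr; congr (_ * _).
rewrite exchange_big; apply: eq_bigr => s _ /=.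
rewrite exchange_big; apply: eq_bigr => s' _ /=.
by rewrite mulr_sumr.
Qed.

End HadamardTests.

(** * Statistics of swap tests *)

Section SwapTests.
Variables (R : realType) (n T : nat) (A : {set 'I_n}) (rho : op R 'I_n).
Hypothesis drho : density rho.
Local Notation W := ('I_(T + T) * 'I_n)%type.
Local Notation P := (side_purity A rho).
Local Notation bn := (bits 'I_n).

(** Test [i] compares copies [i] and [T + i]. *)
Definition test_index (c : 'I_(T + T)) : 'I_T :=
  match fintype.split c with inl i => i | inr i => i end.

Definition partner (c : 'I_(T + T)) : 'I_(T + T) :=
  match fintype.split c with inl i => rshift T i | inr i => lshift T i end.

Definition swap_sides (s : bits 'I_T) (w : bits W) : bits W :=
  [ffun p => if (p.2 \in A) && s (test_index p.1) then w (partner p.1, p.2) else w p].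

Lemma split_lshift (i : 'I_T) : fintype.split (lshift T i) = inl i :> 'I_T + 'I_T.
Proof. exact: (unsplitK (inl i)). Qed.

Lemma split_rshift (i : 'I_T) : fintype.split (rshift T i) = inr i :> 'I_T + 'I_T.
Proof. exact: (unsplitK (inr i)). Qed.

Lemma partnerK : involutive partner.
Proof.
move=> c; rewrite -(fintype.splitK c); case: (fintype.split c) => i;
by rewrite /= /partner ?split_lshift ?split_rshift ?split_lshift.
Qed.

Lemma test_index_partner c : test_index (partner c) = test_index c.
Proof.
rewrite -(fintype.splitK c); case: (fintype.split c) => i /=;
by rewrite /partner /test_index ?split_lshift ?split_rshift ?split_lshift.
Qed.

Lemma swap_sidesK s : involutive (swap_sides s).
Proof.
move=> w; apply/ffunP => -[c q]; rewrite ffunE /=.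
by case: ifP => h; rewrite ffunE /= ?test_index_partner ?partnerK h.
Qed.

Lemma pull_swap_l s w i : pull (pair (lshift T i)) (swap_sides s w) =
  if s i then mix A (pull (pair (rshift T i)) w) (pull (pair (lshift T i)) w)
  else pull (pair (lshift T i)) w.
Proof.
apply/ffunP => q; rewrite pullE ffunE /= /test_index /partner split_lshift.
by case: (s i); rewrite ?andbT ?andbF !ffunE.
Qed.

Lemma pull_swap_r s w i : pull (pair (rshift T i)) (swap_sides s w) =
  if s i then mix A (pull (pair (lshift T i)) w) (pull (pair (rshift T i)) w)
  else pull (pair (rshift T i)) w.
Proof.
apply/ffunP => q; rewrite pullE ffunE /= /test_index /partner split_rshift.
by case: (s i); rewrite ?andbT ?andbF !ffunE.
Qed.

Definition cond_mix (b : bool) (u u' : bn) : bn := if b then mix A u' u else u.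

Lemma big_copy_pairs (F : 'I_T -> bn -> bn -> R[i]) :
  \sum_(w : bits W) \prod_i F i (pull (pair (lshift T i)) w) (pull (pair (rshift T i)) w)
  = \prod_i \sum_u \sum_u' F i u u'.
Proof.
under [RHS]eq_bigr do rewrite pair_big /=.
rewrite bigA_distr_bigA /=.
pose g (f : {ffun 'I_T -> bn * bn}) : bits W :=
  [ffun p => match fintype.split p.1 with inl i => (f i).1 p.2 | inr i => (f i).2 p.2 end].
rewrite (reindex g) /=; last first.
  apply: onW_bij; exists (fun w =>
    [ffun i => (pull (pair (lshift T i)) w, pull (pair (rshift T i)) w)]) => [f|w].
    apply/ffunP => i; rewrite ffunE [RHS]surjective_pairing; congr (_, _);
    by apply/ffunP => q; rewrite pullE ffunE /= ?split_lshift ?split_rshift.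
  apply/ffunP => -[c q]; rewrite -(fintype.splitK c); case: (fintype.split c) => i /=;
  by rewrite !ffunE /= ?split_lshift ?split_rshift ffunE /= pullE.
apply: eq_bigr => f _; apply: eq_bigr => i _; congr (F i _ _);
by apply/ffunP => q; rewrite pullE ffunE /= ?split_lshift ?split_rshift.
Qed.

Lemma mix_involutive : involutive (fun p : bn * bn => (mix A p.2 p.1, mix A p.1 p.2)).
Proof.
move=> [u u'] /=; congr (_, _); apply/ffunP => q; rewrite !ffunE;
by case: (q \in A).
Qed.

(** Equal settings give the squared trace of [rho], because [mix_involutive] reindexes the pairs;
    different settings leave one swap under the trace, hence the purity. *)
Lemma swap_test_sum (b b' : bool) :
  \sum_u \sum_u' entry rho (cond_mix b u u') (cond_mix b' u u') *
                 entry rho (cond_mix b u' u) (cond_mix b' u' u) =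
  if b == b' then 1 else P%:C%C.
Proof.
have sum1 : \sum_u \sum_u' entry rho u u * entry rho u' u' = 1.
  by rewrite -big_distrlr /= -mxtrace_entry drho.2 mulr1.
case: b; case: b' => //=.
- rewrite -[RHS]sum1 !pair_big /= [RHS](reindex_inj (inv_inj mix_involutive)) /=.
  by apply: eq_bigr => -[u u'].
- by rewrite side_purity_mix.
- rewrite side_purity_mix // !pair_big /=.
  rewrite [RHS](reindex_inj (inv_inj mix_involutive)) /=.
  apply: eq_bigr => -[u u'] _ /=.
  by have := mix_involutive (u, u') => /= -[-> ->].
Qed.

Lemma tensor_power_swap_sum s s' :
  \sum_w entry (tensor_power (T + T) rho) (swap_sides s w) (swap_sides s' w) =
  \prod_i (if s i == s' i then 1 else P%:C%C).
Proof.
under [RHS]eq_bigr do rewrite -swap_test_sum.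
rewrite -big_copy_pairs; apply: eq_bigr => w _; rewrite entry_opmx big_split_ord /=.
rewrite -big_split; apply: eq_bigr => i _ /=.
by rewrite !pull_swap_l !pull_swap_r.
Qed.

Lemma swap_test_weight (b : bool) :
  4^-1 * \sum_(c : bool) \sum_(c' : bool) (-1) ^+ (b && c) * (-1) ^+ (b && c') *
     (if c == c' then 1 else P%:C%C) = ((1 + (-1) ^+ b * P) / 2)%:C%C :> R[i].
Proof.
rewrite !big_bool /= rmorphM rmorphD rmorph1 fmorphV rmorph_nat rmorphM /=.
by case: b; rewrite /= ?expr1 ?expr0 ?rmorphN ?rmorph1 /=; field.
Qed.

(** The sums over [s] and [s'] factor over the tests: the outcomes are independent, each being 1
    with probability [(1 - P) / 2]. *)
Lemma sum_Had_signs (y : bits 'I_T) :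
  4 ^- T * \sum_s \sum_s' Had_sign R y s * Had_sign R y s' *
     \sum_w entry (tensor_power (T + T) rho) (swap_sides s w) (swap_sides s' w) =
  (\prod_i ((1 + (-1) ^+ y i * P) / 2))%:C%C.
Proof.
rewrite rmorph_prod /=; under [RHS]eq_bigr do rewrite -swap_test_weight.
rewrite big_split prodr_const card_ord exprVn; congr (_ * _).
rewrite bigA_distr_bigA /=; apply: eq_bigr => s _.
rewrite bigA_distr_bigA /=; apply: eq_bigr => s' _.
by rewrite tensor_power_swap_sum -!big_split.
Qed.

End SwapTests.

(** * The majority of swap tests *)

Section ControlledSwap.
Variable V : finType.
Implicit Types (c a b : V) (y : bits V).

(** The Fredkin gate: of the three CNOTs that make a swap, only the middle one needs the control
    [c]. *)
Definition cswap c a b : seq (gate V) := [:: CX b a; CCX c a b; CX b a].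

Lemma cswapE c a b y v : c != a -> c != b -> a != b ->
  cacts (cswap c a b) y v =
  if y c then (if v == a then y b else if v == b then y a else y v) else y v.
Proof.
move=> ca cb ab; have ba : b != a by rewrite eq_sym.
rewrite /cacts /= !flipE !eqxx ?(negPf ca) ?(negPf cb) ?(negPf ab) ?(negPf ba).
have [->|va] := eqVneq v a.
  by rewrite (negPf ab); case: (y c); case: (y a); case: (y b).
have [->|//] := eqVneq v b; last by case: (y c).
by case: (y c); case: (y a); case: (y b).
Qed.

Lemma cswap_wf c a b : c != a -> c != b -> a != b -> all (@gate_wf _) (cswap c a b).
Proof.
by move=> ca cb ab; rewrite /= !inE negb_or ca cb ab [b == a]eq_sym ab.
Qed.

End ControlledSwap.

Lemma all_flatten_map (I : eqType) (S : Type) (p : pred S) (F : I -> seq S) (s : seq I) :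
  {in s, forall i, all p (F i)} -> all p (flatten [seq F i | i <- s]).
Proof.
elim: s => //= i s IH h; rewrite all_cat h ?mem_head //= IH // => k ks.
by rewrite h // inE ks orbT.
Qed.

Lemma flatten_allpairs (I J S : Type) (F : I -> J -> seq S) (s : seq I) (t : seq J) :
  flatten [seq flatten [seq F i q | q <- t] | i <- s] =
  flatten [seq F p.1 p.2 | p <- [seq (i, q) | i <- s, q <- t]].
Proof.
elim: s => //= i s ->; rewrite map_cat flatten_cat -map_comp; congr (_ ++ _).
Qed.

(** * The tester circuit and its action on basis states *)

Section Tester.
Variables (n K : nat) (A : {set 'I_n}).
Local Notation T := (K.*2.+1).

(* Ancilla 0 is the output, [xwire i] controls the [i]-th swap test, and the  *)
(* [vwire l] count the outcomes 1 in unary: all ones move to the end.         *)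
Definition xwire (i : 'I_T) : 'I_(T + T).+1 := lift ord0 (lshift T i).
Definition vwire (l : nat) : 'I_(T + T).+1 := lift ord0 (rshift T (inord l)).

Section Circuit.
Variables (t : nat) (c0 c1 : 'I_T -> 'I_t).
Local Notation V := ('I_t * 'I_n + 'I_(T + T).+1)%type.

Definition swap_layer : seq (gate V) :=
  flatten [seq flatten [seq if q \in A
      then cswap (inr (xwire i)) (inl (c0 i, q)) (inl (c1 i, q)) else [::]
    | q <- enum 'I_n] | i <- enum 'I_T].

Definition rotation (i : 'I_T) (j : nat) : seq (gate V) :=
  flatten [seq cswap (inr (xwire i)) (inr (vwire l)) (inr (vwire l.+1)) | l <- iota 0 j].

(* If [xwire i] is set, the [cswap]s of the rotation shift the register by    *)
(* one, carrying the bit written on [vwire 0] to its end.                     *)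
Definition count_step (i : 'I_T) : seq (gate V) :=
  CX (inr (xwire i)) (inr (vwire 0)) :: rotation i K.*2.

(** After [c] outcomes 1 the last [c] of the [T] cells are set. As [T - K = K + 1], cell [K] is set
    exactly when more than [K] outcomes are 1, so it carries the majority. *)
Definition count_layer : seq (gate V) :=
  flatten [seq count_step i | i <- enum 'I_T] ++ [:: CX (inr (vwire K)) (inr ord0)].

Definition tester : seq (gate V) :=
  Had_layer _ xwire ++ swap_layer ++ Had_layer _ xwire ++ count_layer.

End Circuit.

Section Semantics.
Local Notation W := ('I_(T + T) * 'I_n)%type.
Local Notation V := (W + 'I_(T + T).+1)%type.
Local Notation c0 := (lshift T : 'I_T -> 'I_(T + T)).
Local Notation c1 := (@rshift T T).

Lemma xwire_inj : injective xwire.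
Proof. by move=> i j /lift_inj/lshift_inj. Qed.

Lemma vwire_eq l l' : (l < T)%N -> (l' < T)%N -> (vwire l == vwire l') = (l == l').
Proof.
move=> lT l'T; rewrite (inj_eq lift_inj) (inj_eq (@rshift_inj _ _)).
by rewrite -val_eqE /= !inordK.
Qed.

Lemma xwire_vwire i l : (xwire i == vwire l) = false.
Proof. by rewrite (inj_eq lift_inj) eq_lrshift. Qed.

Lemma anc_wireP (j : 'I_(T + T).+1) :
  [\/ j = ord0, exists i, j = xwire i | exists2 l, (l < T)%N & j = vwire l].
Proof.
case: (unliftP ord0 j) => [k ->|->]; last by constructor 1.
rewrite -(fintype.splitK k); case: (fintype.split k) => i /=.
  by constructor 2; exists i.
by constructor 3; exists i => //; rewrite /vwire inord_val.
Qed.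

(** Invariant of the induction over the gates: the exchange carried out so far, for the pairs (test,
    qubit) in [L]. *)
Definition swap_part (L : seq ('I_T * 'I_n)) (s : bits 'I_T) (w : bits W) : bits W :=
  [ffun p => if [&& (test_index p.1, p.2) \in L, p.2 \in A & s (test_index p.1)]
             then w (partner p.1, p.2) else w p].

Lemma swap_part_cacts L s w : uniq L ->
  cacts (flatten [seq if p.2 \in A
     then cswap (inr (xwire p.1)) (inl (c0 p.1, p.2)) (inl (c1 p.1, p.2)) else [::]
     | p <- L]) (join w (emb xwire s) : bits V) = join (swap_part L s w) (emb xwire s).
Proof.
elim/last_ind: L => [_|L [i q] IH]; first by congr join; apply/ffunP => p; rewrite ffunE.
rewrite rcons_uniq map_rcons flatten_rcons cacts_cat => /andP[iqL uL]; rewrite IH //=.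
have memL p : (test_index p.1, p.2) \in rcons L (i, q) =
    ((p == (c0 i, q)) || (p == (c1 i, q)) || ((test_index p.1, p.2) \in L)) :> bool.
  rewrite mem_rcons inE; congr orb; case: p => c r; rewrite !xpair_eqE -andb_orl /=.
  congr andb; rewrite -(fintype.splitK c).
  case: (fintype.split c) => k; rewrite /test_index /= ?split_lshift ?split_rshift.
    by rewrite eq_lrshift orbF (inj_eq (@lshift_inj _ _)).
  by rewrite eq_rlshift (inj_eq (@rshift_inj _ _)).
have inlE (p1 p2 : W) : (inl p1 == inl p2 :> V) = (p1 == p2).
  by apply/eqP/eqP => [[->]|->].
have c01 : inl (c0 i, q) != inl (c1 i, q) :> V.
  by rewrite inlE xpair_eqE eq_lrshift.
have notL (p : W) : (p == (c0 i, q)) || (p == (c1 i, q)) ->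
    (test_index p.1, p.2) \in L = false.
  by case/orP => /eqP->; rewrite /test_index /= ?split_lshift ?split_rshift (negPf iqL).
apply/ffunP => -[p|j]; last first.
  rewrite join_inr; case: ifP => qA; last by rewrite join_inr.
  by rewrite cswapE //= !join_inr if_same.
rewrite join_inl ffunE memL; case: ifP => qA; last first.
  rewrite join_inl ffunE; case: eqP => [->|_] /=; first by rewrite qA !andbF.
  by case: eqP => [->|_] //=; rewrite qA !andbF.
rewrite cswapE //.
rewrite !join_inr emb_xs; last exact: xwire_inj.
rewrite !join_inl !inlE.
have [->|p0] := eqVneq p (c0 i, q).
  rewrite /= ffunE notL ?eqxx ?orbT //= qA /test_index split_lshift.
  rewrite ffunE notL ?eqxx //= /partner split_lshift.
  by case: (s i).
have [->|p1] := eqVneq p (c1 i, q).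
  rewrite /= ffunE notL ?eqxx ?orbT //= qA /test_index split_rshift.
  rewrite [X in if _ then _ else X]ffunE notL ?eqxx ?orbT //= /partner split_rshift.
  by case: (s i).
by rewrite if_same ffunE.
Qed.

Lemma swap_layerE s w :
  cacts (swap_layer c0 c1) (join w (emb xwire s) : bits V) =
  join (swap_sides A s w) (emb xwire s).
Proof.
rewrite /swap_layer flatten_allpairs.
rewrite swap_part_cacts; last by rewrite allpairs_uniq ?enum_uniq // => -[? ?] [? ?].
congr join; apply/ffunP => p; rewrite !ffunE; congr (if _ then _ else _).
by rewrite allpairs_f ?mem_enum.
Qed.

Definition count_state (y : bits 'I_T) (c : nat) : bits 'I_(T + T).+1 :=
  [ffun j => match unlift ord0 j with
             | Some k => match fintype.split k with
                         | inl i => y i | inr l => (T - c <= l)%N end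
             | None => false end].

Lemma count_state_x y c i : count_state y c (xwire i) = y i.
Proof. by rewrite ffunE liftK split_lshift. Qed.

Lemma count_state_v y c l : (l < T)%N -> count_state y c (vwire l) = (T - c <= l)%N.
Proof. by move=> lT; rewrite ffunE liftK split_rshift inordK. Qed.

Lemma count_state_0 y c : count_state y c ord0 = false.
Proof. by rewrite ffunE unlift_none. Qed.

Lemma emb_count_state y : emb xwire y = count_state y 0.
Proof.
apply/ffunP => j; case: (anc_wireP j) => [->|[i ->]|[l lT ->]].
- rewrite count_state_0 emb_notin //; apply/codomP => -[i /eqP].
  by rewrite (negPf (neq_lift _ _)).
- by rewrite count_state_x emb_xs //; exact: xwire_inj.
- rewrite count_state_v // subn0 leqNgt lT emb_notin //.
  by apply/codomP => -[i /eqP]; rewrite eq_sym xwire_vwire.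
Qed.

Lemma inrE (W' : eqType) (j j' : 'I_(T + T).+1) : (inr j == inr j' :> W' + _) = (j == j').
Proof. by apply/eqP/eqP => [[->]|->]. Qed.

Lemma wire_xv i l : inr (xwire i) != inr (vwire l) :> V.
Proof. by rewrite inrE xwire_vwire. Qed.

Lemma wire_vv l : (l.+1 < T)%N -> inr (vwire l) != inr (vwire l.+1) :> V.
Proof. by move=> lT; rewrite inrE vwire_eq ?(ltnW lT) // neq_ltn ltnSn. Qed.

Lemma rotationS i j : rotation _ i j.+1 = rotation _ i j ++
  cswap (inr (xwire i)) (inr (vwire j)) (inr (vwire j.+1)) :> seq (gate V).
Proof.
rewrite /rotation; have -> : iota 0 j.+1 = iota 0 j ++ [:: j].
  by rewrite -addn1 iotaD.
by rewrite map_cat flatten_cat.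
Qed.

Lemma rotation_off i j (u : bits V) : ~~ u (inr (xwire i)) -> (j < T)%N ->
  cacts (rotation _ i j) u = u.
Proof.
move=> /negPf ux; elim: j => // j IH jT.
rewrite rotationS cacts_cat.
rewrite IH 1?ltnW //; apply/ffunP => v.
by rewrite cswapE ?wire_xv ?wire_vv // ux.
Qed.

(** Successive adjacent transpositions compose to a cycle. The second clause keeps the other wires,
    among them the control, available to the induction. *)
Lemma rotation_on i j (u : bits V) : u (inr (xwire i)) -> (j < T)%N ->
  let u' := cacts (rotation _ i j) u in
  (forall l, (l < T)%N -> u' (inr (vwire l)) =
     if (l < j)%N then u (inr (vwire l.+1))
     else if l == j then u (inr (vwire 0)) else u (inr (vwire l))) /\
  (forall v, (forall l, (l < T)%N -> v != inr (vwire l)) -> u' v = u v).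
Proof.
move=> ux; elim: j => [_|j IH jT].
  by split=> // l lT; case: eqVneq => // ->.
have [IH1 IH2] := IH (ltnW jT); rewrite rotationS.
rewrite cacts_cat; set u1 := cacts (rotation _ i j) u in IH1 IH2 *.
have u1x : u1 (inr (xwire i)) by rewrite IH2 // => l lT; rewrite inrE xwire_vwire.
have sw v : cacts (cswap (inr (xwire i)) (inr (vwire j)) (inr (vwire j.+1))) u1 v =
  if v == inr (vwire j) then u1 (inr (vwire j.+1)) else
  if v == inr (vwire j.+1) then u1 (inr (vwire j)) else u1 v.
  by rewrite cswapE ?wire_xv ?wire_vv // u1x.
split=> [l lT|v hv].
  rewrite /= sw !inrE !vwire_eq ?(ltnW jT) // !IH1 ?(ltnW jT) //.
  have [->|lj] := eqVneq l j; first by rewrite ltnSn ltnNge leqnSn /= gtn_eqF.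
  have [->|lj1] := eqVneq l j.+1; first by rewrite ltnn ltnn eqxx.
  have -> : (l < j.+1)%N = (l < j)%N by rewrite ltnS leq_eqVlt (negPf lj).
  by case: ltnP.
by rewrite /= sw !(negPf (hv _ _)) ?(ltnW jT) // IH2.
Qed.

Lemma count_stepE i w y c : (c < T)%N ->
  cacts (count_step _ i) (join w (count_state y c) : bits V) =
  join w (count_state y (c + y i)).
Proof.
move=> cT; rewrite /count_step -cat1s cacts_cat.
set u := cacts [:: _] _.
(* Cell 0 is still clear because [c < T], so the CNOT writes the outcome there. *)
have uE v : u v = if v == inr (vwire 0) then y i else join w (count_state y c) v.
  rewrite /u /= flipE join_inr count_state_x; case: eqVneq => // ->.
  by rewrite join_inr count_state_v // leqn0 subn_eq0 leqNgt cT.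
have ux : u (inr (xwire i)) = y i.
  by rewrite uE inrE xwire_vwire join_inr count_state_x.
case yi : (y i); last first.
  rewrite rotation_off ?ux ?yi // addn0; apply/ffunP => v; rewrite uE yi.
  case: eqVneq => // ->; rewrite join_inr count_state_v // leqn0 subn_eq0.
  by rewrite leqNgt cT.
have ux1 : u (inr (xwire i)) by rewrite ux yi.
have [h1 h2] := rotation_on ux1 (ltnSn K.*2).
rewrite addn1; apply/ffunP => -[p|j].
  by rewrite h2 // uE /= !join_inl.
rewrite join_inr; case: (anc_wireP j) => [->|[i' ->]|[l lT ->]].
- rewrite h2 => [|l lT]; last by rewrite inrE /vwire (negPf (neq_lift _ _)).
  by rewrite uE inrE (negPf (neq_lift _ _)) join_inr !count_state_0.
- rewrite h2 => [|l lT]; last by rewrite inrE xwire_vwire.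
  by rewrite uE inrE xwire_vwire join_inr !count_state_x.
rewrite h1 // count_state_v //; case: ltnP => [lK|lK].
  rewrite uE inrE vwire_eq // join_inr count_state_v // subnS.
  by case: (T - c)%N.
have -> : l = K.*2 by apply/eqP; rewrite eqn_leq lK andbT -ltnS.
rewrite eqxx uE eqxx yi subnS; apply/esym; rewrite -ltnS prednK ?subn_gt0 //.
by rewrite leq_subr.
Qed.

Lemma count_stepsE w y (s : seq 'I_T) c : (c + size s <= T)%N ->
  cacts (flatten [seq count_step _ i | i <- s]) (join w (count_state y c) : bits V) =
  join w (count_state y (c + \sum_(i <- s) y i)).
Proof.
elim: s c => [|i s IH] c h; first by rewrite big_nil addn0.
rewrite map_cons -cat1s flatten_cat cacts_cat [flatten [:: _]]cats0.
rewrite count_stepE; last by move: h => /=; lia.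
rewrite IH ?big_cons ?addnA //; move: h => /=; case: (y i); lia.
Qed.

Lemma count_layerE w y :
  cacts (count_layer _) (join w (emb xwire y) : bits V) (inr ord0) =
  (K < \sum_i y i)%N.
Proof.
rewrite /count_layer cacts_cat emb_count_state count_stepsE ?size_enum_ord //.
rewrite /cacts /= flipE eqxx !join_inr count_state_0 add0n big_enum /=.
rewrite count_state_v; last by lia.
by rewrite leq_subLR -ltnS -addSn; move: (\sum_(i < _) _)%N => c; lia.
Qed.

End Semantics.
End Tester.

Section TesterAcceptance.
Variables (n K : nat) (A : {set 'I_n}).
Local Notation T := (K.*2.+1).

Lemma tester_wf (t : nat) (c0 c1 : 'I_T -> 'I_t) : (forall i j, c0 i != c1 j) ->
  all (@gate_wf _) (tester A c0 c1).
Proof.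
move=> c01; have hH : all (@gate_wf _) (Had_layer ('I_t * 'I_n)%type (@xwire K)).
  by rewrite all_map; apply/allP.
rewrite /tester !all_cat hH /=; apply/andP; split.
  apply: all_flatten_map => i _; apply: all_flatten_map => q _; case: ifP => // _.
  by apply: cswap_wf => //; apply: contra (c01 i i) => /eqP[->].
rewrite andbT.
apply: all_flatten_map => i _; rewrite /= inrE xwire_vwire /=.
apply: all_flatten_map => l; rewrite mem_iota add0n => /andP[_ lK].
apply: cswap_wf; rewrite inrE ?xwire_vwire //.
by rewrite vwire_eq // 1?ltnW // neq_ltn ltnSn.
Qed.

Lemma tester_classical (t : nat) (c0 c1 : 'I_T -> 'I_t) :
  all (@classical _) (swap_layer A c0 c1) /\
  all (@classical _) (count_layer n K t).
Proof.
split; first by apply: all_flatten_map => i _; apply: all_flatten_map => q _; case: ifP.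
rewrite all_cat andbT; apply: all_flatten_map => i _ /=.
exact: all_flatten_map.
Qed.

End TesterAcceptance.

(** * Bounds on the majority of biased bits *)

Section MajorityBounds.
Variables (R : realType) (K : nat).
Local Notation T := (K.*2.+1).

Definition ones (y : bits 'I_T) : nat := (\sum_i y i)%N.

Definition majority_prob (p : R) : R :=
  \sum_(y : bits 'I_T | (K < ones y)%N) \prod_i ((1 + (-1) ^+ y i * p) / 2).

Lemma weight_ge0 (p : R) (b : bool) : 0 <= p <= 1 -> 0 <= (1 + (-1) ^+ b * p) / 2.
Proof. by case: b => /andP[? ?]; rewrite /= ?expr1 ?expr0; lra. Qed.

Lemma sum_weights (p : R) :
  \sum_(y : bits 'I_T) \prod_i ((1 + (-1) ^+ y i * p) / 2) = 1.
Proof.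
rewrite -(bigA_distr_bigA (fun _ (b : bool) => (1 + (-1) ^+ b * p) / 2)) big1 // => i _.
by rewrite big_bool /=; field.
Qed.

Lemma majority_prob_ge0 p : 0 <= p <= 1 -> 0 <= majority_prob p.
Proof. by move=> p01; apply: sumr_ge0 => y _; apply: prodr_ge0 => i _; apply: weight_ge0. Qed.

Lemma majority_prob_le1 p : 0 <= p <= 1 -> majority_prob p <= 1.
Proof.
move=> p01; rewrite -(sum_weights p) [leRHS](bigID (fun y => (K < ones y)%N)) /= lerDl.
by apply: sumr_ge0 => y _; apply: prodr_ge0 => i _; apply: weight_ge0.
Qed.

Lemma ones_compl (y : bits 'I_T) : (ones [ffun i => ~~ y i] + ones y = T)%N.
Proof.
rewrite /ones -big_split /= -[RHS]card_ord -sum1_card; apply: eq_bigr => i _.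
by rewrite ffunE; case: (y i).
Qed.

(** Complementation exchanges majorities and minorities, [T] being odd. *)
Lemma card_majority : #|[pred y : bits 'I_T | (K < ones y)%N]|.*2 = (2 ^ T)%N.
Proof.
have <- : #|{: bits 'I_T}| = (2 ^ T)%N by rewrite card_ffun card_bool card_ord.
rewrite -addnn -(cardC [pred y : bits 'I_T | (K < ones y)%N]); congr addn.
pose neg (y : bits 'I_T) : bits 'I_T := [ffun i => ~~ y i].
have negK : involutive neg by move=> y; apply/ffunP => i; rewrite !ffunE negbK.
rewrite -(fintype.card_image (inv_inj negK)); apply: eq_card => y.
rewrite -[y]negK fintype.mem_image ?inE; last exact: inv_inj.
by have := ones_compl (neg y); rewrite -/(neg _); lia.
Qed.

(** Every outcome weighs at least [((1 - p) / 2)^T] and half of the [2^T] outcomes are majorities;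
    Bernoulli's inequality bounds [(1 - p)^T] from below. *)
Lemma majority_prob_ge p : 0 <= p <= 1 -> (1 - T%:R * p) / 2 <= majority_prob p.
Proof.
move=> p01; have /andP[p0 p1] := p01.
have q0 : 0 <= 1 - p by rewrite subr_ge0.
apply: (@le_trans _ _ ((1 - p) ^+ T / 2)).
  rewrite ler_pM2r ?invr_gt0 //.
  elim: T => [|m IH]; first by rewrite mul0r subr0.
  rewrite exprS; apply: (@le_trans _ _ ((1 - p) * (1 - m%:R * p))); last first.
    by rewrite ler_wpM2l.
  have m0 : 0 <= m%:R :> R by rewrite ler0n.
  by rewrite -natr1; nra.
have -> : (1 - p) ^+ T / 2 =
    \sum_(y : bits 'I_T | (K < ones y)%N) \prod_(i < T) ((1 - p) / 2).
  rewrite sumr_const prodr_const card_ord.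
  have := card_majority; set c := #|_| => hc.
  have c2 : c%:R * 2 = 2 ^+ T :> R by rewrite -natrM muln2 hc natrX.
  rewrite -(mulr_natr _ c) expr_div_n -c2.
  have c0 : c%:R != 0 :> R.
    apply/eqP => c0; move: c2; rewrite c0 mul0r => /esym/eqP.
    by rewrite expf_eq0 pnatr_eq0 andbF.
  by field.
apply: ler_sum => y _; apply: ler_prod => i _; apply/andP; split.
  by rewrite divr_ge0.
by case: (y i); rewrite /= ?expr1 ?expr0; lra.
Qed.

(** Bernoulli gives [1 + k x <= (1 + x)^k], and [(1 - x^2)^k <= 1]. *)
Lemma inv_bernoulli (x : R) (k : nat) : 0 <= x <= 1 -> (1 - x) ^+ k <= (1 + k%:R * x)^-1.
Proof.
move=> /andP[x0 x1]; have h0 : 0 < 1 + k%:R * x by rewrite ltr_wpDr // mulr_ge0.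
rewrite -[leRHS]mul1r ler_pdivlMr //.
apply: (@le_trans _ _ (((1 - x) * (1 + x)) ^+ k)).
  rewrite exprMn ler_wpM2l ?exprn_ge0 ?subr_ge0 //.
  elim: k {h0} => [|k IH]; first by rewrite mul0r addr0.
  rewrite exprSr -natr1; have k0 : 0 <= k%:R :> R by rewrite ler0n.
  by nra.
by apply: exprn_ile1; nra.
Qed.

(* An outcome with [c > K] ones and [b] zeros has weight                      *)
(* [(1 - p)^c (1 + p)^b / 2^T], and [(1 - p)^2 <= 1 - p^2].                   *)
Lemma majority_prob_le p : 0 <= p <= 1 ->
  majority_prob p <= (1 + K%:R * p ^+ 2)^-1.
Proof.
move=> p01; have /andP[p0 p1] := p01.
have q0 : 0 <= 1 - p by rewrite subr_ge0.
have pp : 0 <= p ^+ 2 <= 1 by rewrite sqr_ge0 expr_le1.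
apply: le_trans (inv_bernoulli K pp); set r := 1 - p ^+ 2.
have r0 : 0 <= r by rewrite subr_ge0; case/andP: pp.
have term (y : bits 'I_T) : (K < ones y)%N ->
    \prod_i ((1 + (-1) ^+ y i * p) / 2) <= r ^+ K / 2 ^+ T.
  move=> Ky.
  have -> : \prod_i ((1 + (-1) ^+ y i * p) / 2) =
     (1 - p) ^+ ones y * (1 + p) ^+ ones [ffun i => ~~ y i] / 2 ^+ T.
    have -> : 2 ^+ T = \prod_(i < T) 2 :> R by rewrite prodr_const card_ord.
    rewrite /ones -!prodrXr -big_split -prodf_div; apply: eq_bigr => i _ /=; rewrite ffunE.
    by case: (y i); rewrite /= ?expr1 ?expr0 ?mulN1r ?mul1r ?mulr1.
  rewrite ler_pM2r ?invr_gt0 ?exprn_gt0 //.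
  have := ones_compl y; move: (ones _) (ones y) Ky => b c Kc bc.
  (* Each of the [b] zeros is paired with a one, contributing [r]; the [2 (K - b) + 1] ones left
     over contribute at most [r^(K - b)]. *)
  have -> : c = (b + (K - b).*2.+1)%N by lia.
  have bK : (b <= K)%N by lia.
  rewrite exprD mulrAC -exprMn -[in leRHS](subnKC bK) exprD.
  have -> : (1 - p) * (1 + p) = r by rewrite /r; ring.
  rewrite ler_wpM2l ?exprn_ge0 // exprS -mul2n exprM.
  apply: (@le_trans _ _ (((1 - p) ^+ 2) ^+ (K - b))).
    by rewrite ler_piMl ?exprn_ge0 //; lra.
  by apply: lerXn2r; rewrite ?nnegrE ?exprn_ge0 // /r; nra.
apply: (@le_trans _ _ (\sum_(y : bits 'I_T) r ^+ K / 2 ^+ T)).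
  rewrite [leRHS](bigID (fun y => (K < ones y)%N)) /=.
  apply: le_trans (ler_sum _ term) _; rewrite lerDl sumr_ge0 // => y _.
  by rewrite divr_ge0 ?exprn_ge0.
rewrite sumr_const card_ffun card_bool card_ord -(mulr_natr (_ / _)) natrX.
by rewrite mulfVK ?expf_neq0.
Qed.

End MajorityBounds.

Section TesterValue.
Variables (R : realType) (n K : nat) (A : {set 'I_n}).
Local Notation T := (K.*2.+1).

Lemma tester_accept_pairs (rho : op R 'I_n) : density rho ->
  accept_prob (tester A (lshift T) (@rshift T T)) (tensor_power (T + T) rho) =
  majority_prob K (side_purity A rho).
Proof.
move=> drho; have [cl1 cl2] := tester_classical A (lshift T) (@rshift T T).
have wf : all (@gate_wf _) (count_layer n K (T + T)).
  have : all (@gate_wf _) (tester A (lshift T) (@rshift T T)).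
    by apply: tester_wf => i j; rewrite eq_lrshift.
  by rewrite !all_cat => /and4P[].
rewrite /tester (accept_prob_tests (@xwire_inj K) cl1 cl2 wf
  (swap_sidesK A) (fun w s => swap_layerE A s w) (@count_layerE n K)).
under eq_bigr => y _ do rewrite sum_Had_signs //.
by rewrite -rmorph_sum.
Qed.

(** The number of copies has to be the value of a polynomial, which equals [T + T] only
    propositionally; hence the cast. *)
Definition copy_l (t : nat) (e : (T + T)%N = t) (i : 'I_T) : 'I_t :=
  cast_ord e (lshift T i).
Definition copy_r (t : nat) (e : (T + T)%N = t) (i : 'I_T) : 'I_t :=
  cast_ord e (rshift T i).

Lemma tester_accept (t : nat) (e : (T + T)%N = t) (rho : op R 'I_n) : density rho ->
  accept_prob (tester A (copy_l e) (copy_r e)) (tensor_power t rho) =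
  majority_prob K (side_purity A rho).
Proof.
move=> drho; case: t / e; rewrite -tester_accept_pairs //.
have -> : copy_l erefl = lshift T :> ('I_T -> 'I_(T + T)).
  by apply/funext => i; apply: val_inj.
by have -> : copy_r erefl = @rshift T T by apply/funext => i; apply: val_inj.
Qed.

End TesterValue.

(** * Programs *)

Section Programs.

Lemma upd_eq (s : store) i u : upd s i u i = u.
Proof. by rewrite /upd eqxx. Qed.

Lemma upd_neq (s : store) i j u : j != i -> upd s i u j = s j.
Proof. by rewrite /upd => /negPf->. Qed.

Lemma upd_upd (s : store) i u v : upd (upd s i u) i v = upd s i v.
Proof. by apply/funext => j; rewrite /upd; case: eqP. Qed.

Lemma updC (s : store) i j u v : i != j -> upd (upd s i u) j v = upd (upd s j v) i u.
Proof.
move=> ij; apply/funext => k; rewrite /upd; case: eqP => [->|] //.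
by rewrite eq_sym (negPf ij).
Qed.

Lemma upd_id (s : store) i : upd s i (s i) = s.
Proof. by apply/funext => j; rewrite /upd; case: eqP => [->|]. Qed.

Definition runs (P : cmd) (s s' : store) (B : nat) : Prop :=
  exists2 T, exec P s T s' & (T <= B)%N.

Lemma runs_seq P1 P2 s1 s2 s3 B1 B2 :
  runs P1 s1 s2 B1 -> runs P2 s2 s3 B2 -> runs (Seq P1 P2) s1 s3 (B1 + B2).
Proof.
move=> [T1 e1 b1] [T2 e2 b2]; exists (T1 + T2)%N; last exact: leq_add.
exact: ExecSeq e1 e2.
Qed.

(* The word on [o] grows towards the top of the stack, so it is stored in     *)
(* reverse.                                                                   *)
Definition emits (o : nat) (s : store) (P : cmd) (w : seq bool) (B : nat) : Prop :=
  forall u, runs P (upd s o u) (upd s o (catrev w u)) B.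

Lemma emits_skip o s : emits o s Skip [::] 1.
Proof. by move=> u; exists 1%N => //; apply: ExecSkip. Qed.

Lemma emits_push o s b : emits o s (Push b o) [:: b] 1.
Proof.
move=> u; exists 1%N => //.
by have := ExecPush b o (upd s o u); rewrite upd_upd upd_eq.
Qed.

Lemma emits_seq o s P1 P2 w1 w2 B1 B2 : emits o s P1 w1 B1 -> emits o s P2 w2 B2 ->
  emits o s (Seq P1 P2) (w1 ++ w2) (B1 + B2).
Proof.
by move=> h1 h2 u; rewrite catrev_catl; apply: runs_seq (h1 u) (h2 _).
Qed.

Fixpoint indexed_word (F : nat -> bool -> seq bool) (k : nat) (l : seq bool) :=
  if l is b :: l' then F k b ++ indexed_word F k.+1 l' else [::].

(** Popped letters go to [j], so the body can read the loop index as the size of that stack. *)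
Definition loop (i j : nat) (P0 P1 : cmd) : cmd :=
  While i (Case i Skip (Seq P0 (Push false j)) (Seq P1 (Push true j))).

Lemma loop_runs o i j P0 P1 s F B0 B1 l d k :
  o != i -> o != j -> i != j ->
  (forall l1 b l2, l = l1 ++ b :: l2 ->
     emits o (upd (upd s i l2) j (catrev l1 d)) (if b then P1 else P0)
       (F (k + size l1)%N b) (if b then B1 else B0)) ->
  forall u, runs (loop i j P0 P1) (upd (upd (upd s i l) j d) o u)
     (upd (upd (upd s i [::]) j (catrev l d)) o (catrev (indexed_word F k l) u))
     (size l * (B0 + B1 + 3) + 1).
Proof.
move=> oi oj ij; elim: l d k => [|b l IH] d k h u.
  exists 1%N => //; apply: ExecWhileE.
  by rewrite upd_neq 1?eq_sym // upd_neq // upd_eq.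
have [T1 e1 b1] := h [::] b l erefl u.
have [|T2 e2 b2] := IH (b :: d) k.+1 _ (catrev (F k b) u).
  move=> l1 b' l2 e; have := h (b :: l1) b' l2; rewrite e /= addnS addSn; exact.
rewrite addn0 in e1; exists (T1.+2 + T2).+1; last first.
  by rewrite [size _]/= mulSn; case: b b1 {e1 e2 h} => /= b1; lia.
rewrite /= catrev_catl.
apply: (@ExecWhileN _ _ _ T1.+2 _ _ _ _ _ e2).
  by rewrite upd_neq 1?eq_sym // upd_neq // upd_eq.
have -> : upd (upd (upd s i (b :: l)) j d) o u =
    upd (upd (upd s j d) o u) i (b :: l).
  by rewrite (updC _ _ _ ij) updC // eq_sym.
have e : exec (Seq (if b then P1 else P0) (Push b j))
   (upd (upd (upd (upd s j d) o u) i (b :: l)) i l) (T1 + 1)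
   (upd (upd (upd s i l) j (b :: d)) o (catrev (F k b) u)).
  have <- : upd (upd (upd s i l) j d) o u =
    upd (upd (upd (upd s j d) o u) i (b :: l)) i l.
    by rewrite upd_upd (updC _ _ _ ij) updC // eq_sym.
  apply: ExecSeq e1 _; have := ExecPush b j (upd (upd (upd s i l) j d) o (catrev (F k b) u)).
  rewrite upd_neq 1?eq_sym // upd_eq (updC _ _ _ oj) upd_upd.
  by rewrite (updC (upd s i l)) // eq_sym.
rewrite addn1 in e; case: b e {e1 e2 b1 b2 h} => e.
  by apply: ExecCaseT e; rewrite upd_eq.
by apply: ExecCaseF e; rewrite upd_eq.
Qed.

End Programs.

Section ForLoops.

Lemma runs_leq P s s' B B' : (B <= B')%N -> runs P s s' B -> runs P s s' B'.
Proof. by move=> BB [T e b]; exists T => //; exact: leq_trans BB. Qed.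

Lemma indexed_word0 k l : indexed_word (fun _ _ => [::]) k l = [::].
Proof. by elim: l k => //= b l IH k. Qed.

(* Bounds the running time of [P] as long as every loop of [P] runs at most   *)
(* [Z] times.                                                                 *)
Fixpoint cost (Z : nat) (P : cmd) : nat :=
  match P with
  | Skip | Push _ _ => 1
  | Case _ P0 P1 P2 => (cost Z P0 + cost Z P1 + cost Z P2).+1
  | Seq P1 P2 => cost Z P1 + cost Z P2
  | While _ P => (Z * (cost Z P).+1).+1
  end.

Lemma cost_poly P : exists p : {poly nat}, forall Z, cost Z P = p.[Z].
Proof.
elim: P => [|b i|i P0 [p0 h0] P1 [p1 h1] P2 [p2 h2]|P1 [p1 h1] P2 [p2 h2]|i P [p h]].
- by exists 1 => Z; rewrite hornerC.
- by exists 1 => Z; rewrite hornerC.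
- by exists (p0 + p1 + p2 + 1) => Z; rewrite !hornerE /= h0 h1 h2 [RHS]addn1.
- by exists (p1 + p2) => Z; rewrite hornerD /= h1 h2.
- exists ('X * (p + 1) + 1) => Z; rewrite !hornerE /= h -[LHS]addn1.
  by rewrite -[p.[Z].+1]addn1.
Qed.

(** The second loop moves the letters back; stack [i] is restored in its original order, so loops
    can be repeated and nested. *)
Definition for_each (i j : nat) (P0 P1 : cmd) : cmd :=
  Seq (loop i j P0 P1) (loop j i Skip Skip).

Lemma emits_for o i j P0 P1 s F Z :
  o != i -> o != j -> i != j -> s j = [::] -> (size (s i) <= Z)%N ->
  (forall l1 b l2, s i = l1 ++ b :: l2 ->
     let P := if b then P1 else P0 in
     emits o (upd (upd s i l2) j (catrev l1 [::])) P (F (size l1) b) (cost Z P)) ->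
  emits o s (for_each i j P0 P1) (indexed_word F 0 (s i)) (cost Z (for_each i j P0 P1)).
Proof.
move=> oi oj ij sj lZ h u.
have e0 : upd (upd s i (s i)) j [::] = s by rewrite upd_id -sj upd_id.
have e1 : upd (upd s j [::]) i (s i) = s by rewrite -sj upd_id upd_id.
have ji : j != i by rewrite eq_sym.
have {}h l1 b l2 : s i = l1 ++ b :: l2 ->
    emits o (upd (upd s i l2) j (catrev l1 [::])) (if b then P1 else P0)
      (F (0 + size l1)%N b) (if b then cost Z P1 else cost Z P0).
  by move=> /h; case: b.
have := loop_runs oi oj ij h u; rewrite e0 => r1.
apply: (@runs_leq _ _ _ ((size (s i) * (cost Z P0 + cost Z P1 + 3) + 1) +
                         (size (s i) * 5 + 1))).
  by rewrite /=; nia.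
apply: runs_seq r1 _.
have := @loop_runs o j i Skip Skip s (fun _ _ => [::]) 1 1
  (catrev (s i) [::]) [::] 0 oj oi ji _ (catrev (indexed_word F 0 (s i)) u).
rewrite indexed_word0 /= !catrevE !cats0 revK size_rev e1 (updC _ _ _ ij).
by apply=> l1 [] l2 _; exact: emits_skip.
Qed.

End ForLoops.

Section Writing.
Variable Z : nat.

Definition writes (o : nat) (s : store) (P : cmd) (w : seq bool) : Prop :=
  emits o s P w (cost Z P).

Lemma writes_skip o s : writes o s Skip [::].
Proof. exact: emits_skip. Qed.

Lemma writes_push o s b : writes o s (Push b o) [:: b].
Proof. exact: emits_push. Qed.

Lemma writes_seq o s P1 P2 w1 w2 :
  writes o s P1 w1 -> writes o s P2 w2 -> writes o s (Seq P1 P2) (w1 ++ w2).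
Proof. exact: emits_seq. Qed.

Lemma writes_eq o s P w w' : w = w' -> writes o s P w -> writes o s P w'.
Proof. by move=> ->. Qed.

Lemma writes_for o i j P0 P1 s F :
  o != i -> o != j -> i != j -> s j = [::] -> (size (s i) <= Z)%N ->
  (forall l1 b l2, s i = l1 ++ b :: l2 ->
     writes o (upd (upd s i l2) j (catrev l1 [::])) (if b then P1 else P0)
       (F (size l1) b)) ->
  writes o s (for_each i j P0 P1) (indexed_word F 0 (s i)).
Proof. exact: emits_for. Qed.

Lemma indexed_word_nseq m k l :
  indexed_word (fun _ _ => nseq m true) k l = nseq (size l * m) true.
Proof. by elim: l k => //= b l IH k; rewrite IH mulSn nseqD. Qed.

Definition copy_size (o i j : nat) : cmd := for_each i j (Push true o) (Push true o).

Lemma writes_size o i j s :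
  o != i -> o != j -> i != j -> s j = [::] -> (size (s i) <= Z)%N ->
  writes o s (copy_size o i j) (nseq (size (s i)) true).
Proof.
move=> oi oj ij sj lZ; rewrite -[size _]muln1 -(indexed_word_nseq 1 0).
by apply: writes_for => // l1 b l2 _; rewrite if_same; exact: writes_push.
Qed.

Definition copy_product (o i j i' j' : nat) : cmd :=
  for_each i j (copy_size o i' j') (copy_size o i' j').

Lemma writes_product o i j i' j' s : uniq [:: o; i; j; i'; j'] ->
  s j = [::] -> s j' = [::] -> (size (s i) <= Z)%N -> (size (s i') <= Z)%N ->
  writes o s (copy_product o i j i' j') (nseq (size (s i) * size (s i')) true).
Proof.
rewrite /= !inE !negb_or => /and5P[/and4P[oi oj oi' oj'] /and3P[ij ii' ij'] /andP[ji' jj'] i'j' _].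
move=> sj sj' lZ lZ'; rewrite -(indexed_word_nseq _ 0).
apply: writes_for => // l1 b l2 _; rewrite if_same.
have e : upd (upd s i l2) j (catrev l1 [::]) i' = s i'.
  by rewrite !upd_neq // eq_sym.
rewrite -e; apply: writes_size; rewrite ?e //.
by rewrite !upd_neq // eq_sym.
Qed.

End Writing.

Local Notation "P ';;' Q" := (Seq P Q) (at level 60, right associativity).

(** * A program writing the description of the tester *)

Section TesterProgram.
Variables (n K Z : nat).
Local Notation T := (K.*2.+1).
Local Notation D := (T * n + T * n)%N.

(* Stack 0 holds the input; the loops move stacks 0, 4 and 6, of sizes [n],   *)
(* [T] and [2 K], onto 10, 11 and 12, so that the size of the latter is the   *)
(* loop index.  Stack 1 receives the output; 9 and 13 are auxiliary.          *)
Record env (s : store) : Prop := Env {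
  env_n : size (s 2) = n;
  env_K : size (s 3) = K;
  env_T : size (s 5) = T;
  env_half : size (s 7) = (T * n)%N;
  env_D : size (s 8) = D;
  env_9 : s 9 = [::];
  env_13 : s 13 = [::];
  env_Z : forall k, (size (s k) <= Z)%N }.

Lemma env_upd s i j l1 b l2 : env s -> s i = l1 ++ b :: l2 ->
  i \in [:: 0; 4; 6]%N -> j \in [:: 10; 11; 12]%N ->
  env (upd (upd s i l2) j (catrev l1 [::])).
Proof.
move=> es si iI jJ; have h k : k \in [:: 2; 3; 5; 7; 8; 9; 13]%N ->
    upd (upd s i l2) j (catrev l1 [::]) k = s k.
  move=> kI; rewrite !upd_neq //.
    by apply: contraTneq kI => ->; move: iI; rewrite !inE => /or3P[] /eqP->.
  by apply: contraTneq kI => ->; move: jJ; rewrite !inE => /or3P[] /eqP->.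
case: es => ? ? ? ? ? ? ? hZ; split; rewrite ?h //.
move=> k; rewrite /upd; case: eqP => _.
  by rewrite catrevE cats0 size_rev (leq_trans _ (hZ i)) // si size_cat leq_addr.
case: eqP => _ //; apply: leq_trans (hZ i); rewrite si size_cat /=; lia.
Qed.

(** Wire numbers follow the layout: [D = 2 T n] wires for the copies, the output, [T] controls, [T]
    counter cells. Qubit [q] of copy [c] has number [c n + q]. *)
Definition wire_x := copy_size 1 8 9 ;; Push true 1 ;; copy_size 1 11 9 ;; Push false 1.
Definition wire_v0 := copy_size 1 8 9 ;; Push true 1 ;; copy_size 1 5 9 ;; Push false 1.
Definition wire_v := copy_size 1 8 9 ;; Push true 1 ;; copy_size 1 5 9 ;;
  copy_size 1 12 9 ;; Push false 1.
Definition wire_vS := copy_size 1 8 9 ;; Push true 1 ;; copy_size 1 5 9 ;;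
  copy_size 1 12 9 ;; Push true 1 ;; Push false 1.
Definition wire_vK := copy_size 1 8 9 ;; Push true 1 ;; copy_size 1 5 9 ;;
  copy_size 1 3 9 ;; Push false 1.
Definition wire_out := copy_size 1 8 9 ;; Push false 1.
Definition wire_l := copy_product 1 11 13 2 9 ;; copy_size 1 10 9 ;; Push false 1.
Definition wire_r := copy_size 1 7 9 ;; wire_l.

Definition write_Had w := Push false 1 ;; Push false 1 ;; w.
Definition write_CX c t := Push true 1 ;; Push false 1 ;; c ;; t.
Definition write_CCX c d t := Push true 1 ;; Push true 1 ;; c ;; d ;; t.
Definition write_cswap c a b := write_CX b a ;; write_CCX c a b ;; write_CX b a.

Definition CX_word (c t : nat) := [:: true; false] ++ unary c ++ unary t.
Definition CCX_word (c d t : nat) := [:: true; true] ++ unary c ++ unary d ++ unary t.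
Definition cswap_word (c a b : nat) := CX_word b a ++ CCX_word c a b ++ CX_word b a.
Definition Had_word (v : nat) := [:: false; false] ++ unary v.

Definition write_Had_layer := for_each 4 11 (write_Had wire_x) (write_Had wire_x).
Definition write_swaps := for_each 0 10 Skip (write_cswap wire_x wire_l wire_r).
Definition write_swap_layer := for_each 4 11 write_swaps write_swaps.
Definition write_rotation := for_each 6 12 (write_cswap wire_x wire_v wire_vS)
                                           (write_cswap wire_x wire_v wire_vS).
Definition write_count_step := write_CX wire_x wire_v0 ;; write_rotation.
Definition write_count_layer := for_each 4 11 write_count_step write_count_step.
Definition write_header := copy_size 1 5 9 ;; copy_size 1 5 9 ;; Push true 1 ;; Push false 1.

Definition write_tester := write_header ;; write_Had_layer ;; write_swap_layer ;;
  write_Had_layer ;; write_count_layer ;; write_CX wire_vK wire_out.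

Lemma unaryE m : unary m = nseq m true ++ [:: false].
Proof. by rewrite /unary -cats1. Qed.

Local Notation writes1 := (writes Z 1).

Ltac write_wire es :=
  eapply writes_eq; cycle 1;
    [ repeat first [ apply: writes_push
                   | (apply: writes_size;
                      [done | done | done | exact: (env_9 es) | exact: (env_Z es)])
                   | apply: writes_seq ] | ].

Lemma writes_wire_x s : env s ->
  writes1 s wire_x (unary (D + (1 + size (s 11)))).
Proof. by move=> es; write_wire es; rewrite unaryE (env_D es) !nseqD -!catA. Qed.

Lemma writes_wire_v0 s : env s -> writes1 s wire_v0 (unary (D + (1 + (T + 0)))).
Proof.
move=> es; write_wire es.
by rewrite unaryE addn0 (env_D es) (env_T es) !nseqD -!catA.
Qed.

Lemma writes_wire_v s : env s ->
  writes1 s wire_v (unary (D + (1 + (T + size (s 12))))).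
Proof.
move=> es; write_wire es.
by rewrite unaryE (env_D es) (env_T es) !nseqD -!catA.
Qed.

Lemma writes_wire_vS s : env s ->
  writes1 s wire_vS (unary (D + (1 + (T + (size (s 12)).+1)))).
Proof.
move=> es; write_wire es.
by rewrite unaryE (env_D es) (env_T es) -(addn1 (size (s 12))) !nseqD -!catA.
Qed.

Lemma writes_wire_vK s : env s -> writes1 s wire_vK (unary (D + (1 + (T + K)))).
Proof.
move=> es; write_wire es.
by rewrite unaryE (env_D es) (env_T es) (env_K es) !nseqD -!catA.
Qed.

Lemma writes_wire_out s : env s -> writes1 s wire_out (unary (D + 0)).
Proof. by move=> es; write_wire es; rewrite unaryE addn0 (env_D es). Qed.

Lemma writes_wire_l s : env s ->
  writes1 s wire_l (unary (size (s 11) * n + size (s 10))).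
Proof.
move=> es; apply: writes_eq; last first.
  apply: writes_seq.
    by apply: writes_product; rewrite ?(env_9 es) ?(env_13 es) ?(env_Z es).
  by write_wire es.
by rewrite unaryE nseqD -!catA (env_n es).
Qed.

Lemma writes_wire_r s : env s ->
  writes1 s wire_r (unary ((T + size (s 11)) * n + size (s 10))).
Proof.
move=> es; apply: writes_eq; last first.
  apply: writes_seq; last exact: writes_wire_l.
  by apply: writes_size; rewrite ?(env_9 es) ?(env_Z es).
by rewrite !unaryE mulnDl -addnA (nseqD (T * n)) -catA (env_half es).
Qed.

Lemma writes_Had s w v : writes1 s w (unary v) -> writes1 s (write_Had w) (Had_word v).
Proof.
move=> h.
exact: (writes_seq (writes_push Z 1 s false) (writes_seq (writes_push Z 1 s false) h)).
Qed.

Lemma writes_CX s c t vc vt : writes1 s c (unary vc) -> writes1 s t (unary vt) ->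
  writes1 s (write_CX c t) (CX_word vc vt).
Proof.
move=> hc ht; exact: (writes_seq (writes_push Z 1 s true)
  (writes_seq (writes_push Z 1 s false) (writes_seq hc ht))).
Qed.

Lemma writes_CCX s c d t vc vd vt :
  writes1 s c (unary vc) -> writes1 s d (unary vd) -> writes1 s t (unary vt) ->
  writes1 s (write_CCX c d t) (CCX_word vc vd vt).
Proof.
move=> hc hd ht; exact: (writes_seq (writes_push Z 1 s true)
  (writes_seq (writes_push Z 1 s true) (writes_seq hc (writes_seq hd ht)))).
Qed.

Lemma writes_cswap s c a b vc va vb :
  writes1 s c (unary vc) -> writes1 s a (unary va) -> writes1 s b (unary vb) ->
  writes1 s (write_cswap c a b) (cswap_word vc va vb).
Proof.
move=> hc ha hb; apply: writes_seq; first exact: writes_CX.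
by apply: writes_seq; [exact: writes_CCX | exact: writes_CX].
Qed.

Lemma writes_Had_layer s : env s -> s 11 = [::] ->
  writes1 s write_Had_layer
    (indexed_word (fun i _ => Had_word (D + (1 + i))) 0 (s 4)).
Proof.
move=> es s11; apply: writes_for => //; first exact: env_Z.
move=> l1 b l2 e; rewrite if_same; have es' := env_upd (j := 11%N) es e isT isT.
have := writes_Had (writes_wire_x es').
by rewrite upd_eq catrevE cats0 size_rev.
Qed.

Definition swaps_word (i : nat) (l : seq bool) : seq bool :=
  indexed_word (fun q b => if b then cswap_word (D + (1 + i)) (i * n + q) ((T + i) * n + q)
                           else [::]) 0 l.

Lemma writes_swap_layer s : env s -> s 10 = [::] -> s 11 = [::] ->
  writes1 s write_swap_layer (indexed_word (fun i _ => swaps_word i (s 0)) 0 (s 4)).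
Proof.
move=> es s10 s11; apply: writes_for => //; first exact: env_Z.
move=> l1 b l2 e; rewrite if_same.
have es' := env_upd (j := 11%N) es e isT isT.
set s' := upd _ _ _ in es' *.
have -> : s 0 = s' 0 by rewrite /s' !upd_neq.
apply: writes_for => //; first exact: env_Z.
move=> l1' b' l2' e'; case: b' e' => e'; last exact: writes_skip.
have es2 := env_upd (j := 10%N) es' e' isT isT.
have := writes_cswap (writes_wire_x es2) (writes_wire_l es2) (writes_wire_r es2).
rewrite upd_eq !(@upd_neq _ _ 11) // /s' upd_eq !catrevE !cats0 !size_rev.
exact.
Qed.

Definition count_word (i : nat) (l : seq bool) : seq bool :=
  CX_word (D + (1 + i)) (D + (1 + (T + 0))) ++
  indexed_word (fun k _ => cswap_word (D + (1 + i)) (D + (1 + (T + k)))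
                             (D + (1 + (T + k.+1)))) 0 l.

Lemma writes_count_layer s : env s -> s 11 = [::] -> s 12 = [::] ->
  writes1 s write_count_layer (indexed_word (fun i _ => count_word i (s 6)) 0 (s 4)).
Proof.
move=> es s11 s12; apply: writes_for => //; first exact: env_Z.
move=> l1 b l2 e; rewrite if_same.
have es' := env_upd (j := 11%N) es e isT isT.
set s' := upd _ _ _ in es' *.
have s'11 : size (s' 11) = size l1 by rewrite /s' upd_eq catrevE cats0 size_rev.
have -> : s 6 = s' 6 by rewrite /s' !upd_neq.
apply: writes_seq.
  by have := writes_CX (writes_wire_x es') (writes_wire_v0 es'); rewrite s'11.
apply: writes_for => //; first exact: env_Z.
move=> l1' b' l2' e'; rewrite if_same.
have es2 := env_upd (j := 12%N) es' e' isT isT.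
have := writes_cswap (writes_wire_x es2) (writes_wire_v es2) (writes_wire_vS es2).
by rewrite upd_eq !(@upd_neq _ _ 11) // s'11 !catrevE !cats0 !size_rev.
Qed.

Definition tester_word (l lT lK : seq bool) : seq bool :=
  let H := indexed_word (fun i _ => Had_word (D + (1 + i))) 0 lT in
  unary (T + T).+1 ++ H ++ indexed_word (fun i _ => swaps_word i l) 0 lT ++
  H ++ indexed_word (fun i _ => count_word i lK) 0 lT ++
  CX_word (D + (1 + (T + K))) (D + 0).

Lemma writes_tester s : env s -> s 10 = [::] -> s 11 = [::] -> s 12 = [::] ->
  writes1 s write_tester (tester_word (s 0) (s 4) (s 6)).
Proof.
move=> es s10 s11 s12; apply: writes_seq.
  by write_wire es; rewrite (env_T es) unaryE -(addn1 (T + T)) !nseqD -!catA.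
apply: writes_seq; first exact: writes_Had_layer.
apply: writes_seq; first exact: writes_swap_layer.
apply: writes_seq; first exact: writes_Had_layer.
apply: writes_seq; first exact: writes_count_layer.
by apply: writes_CX; [exact: writes_wire_vK | exact: writes_wire_out].
Qed.

End TesterProgram.

(** * Preparation of the stacks and the complete generator *)

Section Generator.

(** A step lengthens a stack by at most one letter. Running time thus bounds the length of the
    output, and with it the cost of moving the output to stack 0. *)
Lemma exec_size P s T s' i : exec P s T s' -> (size (s' i) <= size (s i) + T)%N.
Proof.
elim=> {P s T s'}.
- by move=> s; rewrite leq_addr.
- by move=> b j s; rewrite /upd; case: eqP => [->|_] /=; lia.
- by move=> j ce cf ct s T s' _ _; lia.
- move=> j ce cf ct s u T s' sj _; rewrite /upd; case: eqP => [->|_]; last by lia.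
  by rewrite sj /=; lia.
- move=> j ce cf ct s u T s' sj _; rewrite /upd; case: eqP => [->|_]; last by lia.
  by rewrite sj /=; lia.
- by move=> c1 c2 s1 T1 s2 T2 s3 _ h1 _ h2; lia.
- by move=> j c s _; lia.
- by move=> j c s1 T1 s2 T2 s3 _ _ h1 _ h2; lia.
Qed.

Variable Z : nat.

Lemma runs_writes o s P w : s o = [::] -> writes Z o s P w ->
  runs P s (upd s o (rev w)) (cost Z P).
Proof. by move=> so /(_ [::]); rewrite -{1}so upd_id catrevE cats0. Qed.

Lemma rev_nseq (T : Type) m (x : T) : rev (nseq m x) = nseq m x.
Proof.
elim: m => //= m IH; rewrite rev_cons IH; elim: m {IH} => //= m ->.
by [].
Qed.

Lemma runs_writes_nseq o s P m : s o = [::] -> writes Z o s P (nseq m true) ->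
  runs P s (upd s o (nseq m true)) (cost Z P).
Proof. by move=> so /(runs_writes so); rewrite rev_nseq. Qed.

Lemma loop_skip_runs i j s : i != j -> s j = [::] ->
  runs (loop i j Skip Skip) s (upd (upd s i [::]) j (rev (s i))) (size (s i) * 5 + 1).
Proof.
(* [loop_runs] asks for an output stack; any index other than [i] and [j] will do, as the empty word
   is written. *)
move=> ij sj; pose o := (i + j).+1.
have oi : o != i by rewrite /o; lia.
have oj : o != j by rewrite /o; lia.
have := @loop_runs o i j Skip Skip s (fun _ _ => [::]) 1 1 (s i) [::] 0 oi oj ij _ (s o).
have e0 : upd (upd s i (s i)) j [::] = s by rewrite upd_id -sj upd_id.
rewrite indexed_word0 /= catrevE cats0 e0 upd_id.
have -> : upd (upd (upd s i [::]) j (rev (s i))) o (s o) = upd (upd s i [::]) j (rev (s i)).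
  by have := upd_id (upd (upd s i [::]) j (rev (s i))) o; rewrite !upd_neq.
by apply=> l1 [] l2 _; exact: emits_skip.
Qed.

Definition clear_stack (i : nat) : cmd := While i (Case i Skip Skip Skip).

Lemma clear_stack_runs i s : (size (s i) <= Z)%N ->
  runs (clear_stack i) s (upd s i [::]) (cost Z (clear_stack i)).
Proof.
move=> sZ; apply: (@runs_leq _ _ _ (size (s i) * 3 + 1)); first by rewrite /=; nia.
move: {sZ} (s i) (upd_id s i) => l; elim: l s => [|b l IH] s si.
  by rewrite -{1}si; exists 1%N => //; apply: ExecWhileE; rewrite upd_eq.
have [T e bT] := IH (upd s i l) (upd_upd s i l l).
rewrite upd_upd in e; exists (2 + T).+1; last by rewrite /= mulSn; lia.
have sib : s i = b :: l by rewrite -si upd_eq.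
apply: ExecWhileN e; first by rewrite sib.
by case: b sib {si} => sib; [apply: ExecCaseT sib _ | apply: ExecCaseF sib _]; exact: ExecSkip.
Qed.

(** Multiplies the size of stack 14 by that of stack 2. The product is built on stack 15, since the
    output of [copy_product] must differ from its sources. *)
Definition power_step : cmd :=
  Seq (copy_product 15 14 9 2 10) (Seq (clear_stack 14) (loop 15 14 Skip Skip)).

Fixpoint power (c : nat) : cmd :=
  if c is c'.+1 then Seq (power c') power_step else Push true 14.

Lemma power_runs n c s : s 14 = [::] -> s 15 = [::] -> s 9 = [::] -> s 10 = [::] ->
  size (s 2) = n -> (n <= Z)%N -> (forall k, (k <= c)%N -> (n ^ k <= Z)%N) ->
  runs (power c) s (upd s 14 (nseq (n ^ c) true)) (cost Z (power c)).
Proof.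
move=> s14 s15 s9 s10 s2 nZ; elim: c => [|c IH] hZ.
  by exists 1%N => //; have := ExecPush true 14 s; rewrite s14.
apply: runs_seq (IH (fun k kc => hZ k (leqW kc))) _.
set s1 := upd s 14 _.
have s1_14 : s1 14 = nseq (n ^ c) true by rewrite /s1 upd_eq.
apply: (runs_seq (s2 := upd s1 15 (nseq (n ^ c.+1) true))).
  apply: runs_writes_nseq => //.
  have -> : (n ^ c.+1 = size (s1 14) * size (s1 2))%N.
    by rewrite s1_14 size_nseq expnSr -s2.
  by apply: writes_product => //; rewrite ?s1_14 ?size_nseq ?hZ // -/(s 2) s2.
set s3 := upd s1 15 _.
apply: (runs_seq (s2 := upd s3 14 [::])).
  by apply: clear_stack_runs; rewrite /s3 upd_neq // s1_14 size_nseq hZ.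
set s4 := upd s3 14 _.
have s4_15 : s4 15 = nseq (n ^ c.+1) true by rewrite /s4 upd_neq // /s3 upd_eq.
have -> : upd s 14 (nseq (n ^ c.+1) true) = upd (upd s4 15 [::]) 14 (rev (s4 15)).
  rewrite s4_15 rev_nseq /s4 /s3 /s1; apply/funext => k; rewrite /upd.
  by case: eqP => // _; case: eqP => // ->.
apply: (@runs_leq _ _ _ (size (s4 15) * 5 + 1)).
  by have := hZ _ (leqnn c.+1); rewrite s4_15 size_nseq /=; nia.
exact: loop_skip_runs.
Qed.

End Generator.

Definition unary_stack (m : nat) : seq bool := nseq m true.

Lemma writes_unary Z o i j m s : [&& o != i, o != j & i != j] ->
  s i = unary_stack m -> s j = [::] -> (m <= Z)%N ->
  writes Z o s (copy_size o i j) (unary_stack m).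
Proof.
move=> /and3P[oi oj ij] si sj mZ; have sz : size (s i) = m by rewrite si size_nseq.
by rewrite -sz; apply: writes_size; rewrite ?sz.
Qed.

Lemma unary_stackD m m' : unary_stack m ++ unary_stack m' = unary_stack (m + m').
Proof. by rewrite /unary_stack nseqD. Qed.

Section Setup.
Variables (Z C : nat) (l : seq bool).
Local Notation n := (size l).
Local Notation K := (n ^ C)%N.
Local Notation T := (K.*2.+1).

(** Stacks 4 and 5 both get size [T]: loops run over the former and temporarily deplete it, while
    the latter stays readable as a wire offset. Stacks 0 and 2, of size [n], are split in the same
    way. *)
Definition setup : cmd :=
  copy_size 2 0 9 ;; power C ;; copy_size 3 14 9 ;;
  (copy_size 6 3 9 ;; copy_size 6 3 9) ;; (copy_size 4 6 9 ;; Push true 4) ;;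
  (copy_size 5 6 9 ;; Push true 5) ;; copy_product 7 4 9 2 10 ;;
  (copy_size 8 7 9 ;; copy_size 8 7 9).

Definition setup_store : store :=
  let s0 : store := fun i => nth [::] [:: l] i in
  let s1 := upd s0 2 (unary_stack n) in
  let s2 := upd s1 14 (unary_stack K) in
  let s3 := upd s2 3 (unary_stack K) in
  let s4 := upd s3 6 (unary_stack K.*2) in
  let s5 := upd s4 4 (unary_stack T) in
  let s6 := upd s5 5 (unary_stack T) in
  let s7 := upd s6 7 (unary_stack (T * n)) in
  upd s7 8 (unary_stack (T * n + T * n)).

Hypothesis hZ : forall k, (k <= C)%N -> (n ^ k <= Z)%N.
Hypotheses (nZ : (n <= Z)%N) (TZ : (T <= Z)%N) (DZ : (T * n + T * n <= Z)%N).

Lemma setup_runs : runs setup (fun i => nth [::] [:: l] i) setup_store (cost Z setup).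
Proof.
have KZ : (K <= Z)%N by apply: hZ.
have K2Z : (K.*2 <= Z)%N by apply: ltnW.
have TnZ : (T * n <= Z)%N by apply: leq_trans (leq_addr _ _) DZ.
set s0 : store := fun i => _.
apply: (runs_seq (s2 := upd s0 2 (unary_stack n))).
  by apply: runs_writes_nseq => //; apply: writes_size.
set s1 := upd s0 2 _.
apply: (runs_seq (s2 := upd s1 14 (unary_stack K))).
  by apply: power_runs => //; rewrite /s1 upd_eq size_nseq.
set s2 := upd s1 14 _.
apply: (runs_seq (s2 := upd s2 3 (unary_stack K))).
  by apply: runs_writes_nseq => //; exact: writes_unary.
set s3 := upd s2 3 _.
apply: (runs_seq (s2 := upd s3 6 (unary_stack K.*2))).
  apply: runs_writes_nseq => //; rewrite -addnn -/(unary_stack _) -unary_stackD.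
  by apply: writes_seq; exact: writes_unary.
set s4 := upd s3 6 _.
apply: (runs_seq (s2 := upd s4 4 (unary_stack T))).
  apply: runs_writes_nseq => //; rewrite -[K.*2.+1]addn1 -/(unary_stack _) -unary_stackD.
  by apply: writes_seq; [exact: writes_unary | exact: writes_push].
set s5 := upd s4 4 _.
apply: (runs_seq (s2 := upd s5 5 (unary_stack T))).
  apply: runs_writes_nseq => //; rewrite -[K.*2.+1]addn1 -/(unary_stack _) -unary_stackD.
  by apply: writes_seq; [exact: writes_unary | exact: writes_push].
set s6 := upd s5 5 _.
apply: (runs_seq (s2 := upd s6 7 (unary_stack (T * n)))).
  apply: runs_writes_nseq => //.
  have h4 : size (s6 4) = T by rewrite size_nseq.
  have h2 : size (s6 2) = n by rewrite size_nseq.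
  by rewrite -h4 -h2; apply: writes_product; rewrite ?h4 ?h2.
set s7 := upd s6 7 _.
apply: runs_writes_nseq => //; rewrite -/(unary_stack _) -unary_stackD.
by apply: writes_seq; exact: writes_unary.
Qed.

Lemma setup_env : env n K Z setup_store.
Proof.
have KZ : (K <= Z)%N by apply: hZ.
split; rewrite ?size_nseq //.
move=> k; rewrite /setup_store /upd.
do 8! [case: eqP => _; first by rewrite size_nseq //; lia].
by case: k => [|[|k]] //=; rewrite ?nth_nil.
Qed.

End Setup.

Section GeneratorProgram.
Variable C : nat.

(** The input leaves stack 0 before the output enters. The word lies reversed on stack 1, and moving
    it puts it in the right order. *)
Definition generator : cmd :=
  setup C ;; write_tester ;; loop 0 9 Skip Skip ;; loop 1 0 Skip Skip.

Lemma generator_runs (l : seq bool) (Z : nat) :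
  let n := size l in let K := (n ^ C)%N in let T := (K.*2.+1) in
  (forall k, (k <= C)%N -> (n ^ k <= Z)%N) -> (n <= Z)%N -> (T <= Z)%N ->
  (T * n + T * n <= Z)%N ->
  outputs_within generator [:: l]
    (cost Z (setup C) + (cost Z write_tester + (Z * 5 + 1 + (cost Z write_tester * 5 + 1))))
    (tester_word n K l (nseq T true) (nseq K.*2 true)).
Proof.
move=> n K T hZ nZ TZ DZ.
set w := tester_word _ _ _ _ _; set s := setup_store C l.
have es := setup_env hZ nZ TZ DZ; rewrite -/s in es.
have r2 : runs write_tester s (upd s 1 (rev w)) (cost Z write_tester).
  by apply: runs_writes => //; exact: (writes_tester es).
have wZ : (size w <= cost Z write_tester)%N.
  have [T2 /(exec_size 1) h T2Z] := r2.
  by move: h; rewrite upd_eq size_rev add0n => /leq_trans; apply.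
suff [T0 e0 T0Z] : runs generator (fun i => nth [::] [:: l] i)
  (upd (upd (upd (upd (upd s 1 (rev w)) 0 [::]) 9 (rev l)) 1 [::]) 0 w)
  (cost Z (setup C) + (cost Z write_tester + (Z * 5 + 1 + (cost Z write_tester * 5 + 1)))).
  by eexists T0, _; split; [exact: e0 | exact: T0Z | rewrite upd_eq].
apply: runs_seq; first exact: (setup_runs hZ nZ TZ DZ).
apply: runs_seq r2 _; set s1 := upd s 1 _.
apply: (runs_seq (s2 := upd (upd s1 0 [::]) 9 (rev l))).
  apply: (@runs_leq _ _ _ (size l * 5 + 1)); first by rewrite -/n; nia.
  exact: (@loop_skip_runs 0 9 s1).
set s2 := upd (upd s1 0 _) 9 _.
have s21 : s2 1 = rev w by [].
have := @loop_skip_runs 1 0 s2 isT erefl; rewrite s21 revK size_rev.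
by apply: runs_leq; rewrite leq_add2r leq_mul2r wZ.
Qed.

End GeneratorProgram.

(** * The word written is the circuit description *)

Lemma indexed_word_map (I : Type) (F : nat -> bool -> seq bool) (f : I -> bool)
    (idx : I -> nat) (s : seq I) k : map idx s = iota k (size s) ->
  indexed_word F k (map f s) = flatten [seq F (idx i) (f i) | i <- s].
Proof. by elim: s k => //= i s IH k [-> /IH ->]. Qed.

Lemma indexed_word_enum F m (f : 'I_m -> bool) :
  indexed_word F 0 [seq f i | i <- enum 'I_m] = flatten [seq F (val i) (f i) | i <- enum 'I_m].
Proof. by apply: indexed_word_map; rewrite size_enum_ord; exact: val_enum_ord. Qed.

Lemma indexed_word_ord (G : nat -> seq bool) m :
  indexed_word (fun i _ => G i) 0 (nseq m true) = flatten [seq G (val i) | i <- enum 'I_m].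
Proof.
rewrite -(indexed_word_enum (fun i _ => G i) (fun=> true)); congr indexed_word.
by rewrite -{1}(size_enum_ord m); elim: (enum _) => //= _ s ->.
Qed.

Lemma indexed_word_iota (G : nat -> seq bool) m :
  indexed_word (fun i _ => G i) 0 (nseq m true) = flatten [seq G i | i <- iota 0 m].
Proof. by rewrite indexed_word_ord -val_enum_ord -map_comp. Qed.

Section GatesString.
Variables (W : finType) (num : W -> nat) (a : nat).

Definition gates_string (C : seq (gate (W + 'I_a)%type)) : seq bool :=
  flatten [seq gate_string num g | g <- C].

Lemma gates_string_cat C1 C2 :
  gates_string (C1 ++ C2) = gates_string C1 ++ gates_string C2.
Proof. by rewrite /gates_string map_cat flatten_cat. Qed.

Lemma gates_string_flatten (I : Type) (F : I -> seq (gate (W + 'I_a)%type)) s :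
  gates_string (flatten [seq F i | i <- s]) = flatten [seq gates_string (F i) | i <- s].
Proof. by elim: s => //= i s IH; rewrite gates_string_cat IH. Qed.

Lemma gates_string_cswap (c x y : W + 'I_a) vc vx vy :
  wire_string num c = unary vc -> wire_string num x = unary vx ->
  wire_string num y = unary vy ->
  gates_string (cswap (c : (W + 'I_a)%type) x y) = cswap_word vc vx vy.
Proof.
move=> hc hx hy; rewrite /gates_string /= hc hx hy cats0.
by rewrite /cswap_word /CX_word /CCX_word -!catA.
Qed.

End GatesString.

Section TesterString.
Variables (n K : nat) (A : {set 'I_n}) (t : nat).
Local Notation T := (K.*2.+1).
Local Notation D := (T * n + T * n)%N.
Hypothesis e : (T + T)%N = t.
Local Notation V := ('I_t * 'I_n + 'I_(T + T).+1)%type.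
Local Notation wstring := (@wire_string _ (@copy_num t n) (T + T).+1).

Lemma card_copies : #|{: 'I_t * 'I_n}| = D.
Proof. by rewrite card_prod !card_ord -e mulnDl. Qed.

Lemma wire_string_x i : wstring (inr (xwire i)) = unary (D + (1 + i)).
Proof. by rewrite /wire_string card_copies. Qed.

Lemma wire_string_v l : (l < T)%N -> wstring (inr (vwire K l)) = unary (D + (1 + (T + l))).
Proof. by move=> lT; rewrite /wire_string card_copies /= inordK. Qed.

Lemma wire_string_out : wstring (inr ord0) = unary (D + 0).
Proof. by rewrite /wire_string card_copies. Qed.

(** The nested loops of the program mirror the nested [flatten]s of the circuit; what remains is to
    identify the wire numbers. *)
Lemma tester_string :
  circuit_string (@copy_num t n) (tester A (copy_l e) (copy_r e)) =
  tester_word n K (bipartition_string A) (nseq T true) (nseq K.*2 true).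
Proof.
transitivity (unary (T + T).+1 ++
  gates_string (@copy_num t n) (tester A (copy_l e) (copy_r e))) => //.
have gcat := @gates_string_cat _ (@copy_num t n) (T + T).+1.
have gflat := @gates_string_flatten _ (@copy_num t n) (T + T).+1.
rewrite (etrans (gcat _ _) (congr1 (cat _) (etrans (gcat _ _)
  (congr1 (cat _) (gcat _ _))))) /tester_word.
have -> : gates_string (@copy_num t n) (Had_layer ('I_t * 'I_n)%type (@xwire K)) =
    indexed_word (fun i _ => Had_word (D + (1 + i))) 0 (nseq T true).
  rewrite indexed_word_ord /gates_string -map_comp; congr flatten.
  by apply: eq_map => i /=; rewrite wire_string_x.
have -> : gates_string (@copy_num t n) (swap_layer A (copy_l e) (copy_r e)) =
    indexed_word (fun i _ => swaps_word n K i (bipartition_string A)) 0 (nseq T true).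
  rewrite indexed_word_ord (gflat _ _ _); congr flatten.
  apply: eq_map => i; rewrite (gflat _ _ _) /swaps_word /bipartition_string.
  rewrite indexed_word_enum; congr flatten; apply: eq_map => q; rewrite ffunE.
  by case: ifP => // _; apply: gates_string_cswap; rewrite ?wire_string_x.
rewrite (etrans (gcat _ _) (congr1 (cat^~ _) (gflat _ _ _))).
do 5! congr cat.
  rewrite indexed_word_ord; congr flatten; apply: eq_map => i; rewrite /count_step /count_word.
  rewrite (gcat [:: _] _); congr cat.
    by rewrite /gates_string /= wire_string_x wire_string_v // cats0.
  rewrite (gflat _ _ _) indexed_word_iota; congr flatten.
  apply/eq_in_map => l; rewrite mem_iota add0n => /andP[_ lK].
  by apply: gates_string_cswap; rewrite ?wire_string_x ?wire_string_v // ltnW.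
rewrite /gates_string /= wire_string_v ?wire_string_out ?cats0 //; lia.
Qed.

End TesterString.

(** * Polynomial bounds for the generator *)

Section PolynomialTime.
Variable C : nat.
Local Notation K n := (n ^ C)%N.
Local Notation T n := ((K n).*2.+1).

Definition copies : {poly nat} := 'X^C *+ 4 + 2.

Lemma copiesE n : (T n + T n)%N = copies.[n].
Proof.
rewrite /copies hornerD hornerMn hornerXn -[2]polyC_natr hornerC.
have -> : n ^+ C = K n by elim: C => //= c IH; rewrite exprS IH expnS.
by rewrite !mulrS mulr0n /=; lia.
Qed.

(** The 6 comes from [2 T n = 4 n^(C+1) + 2 n]. Using [n + 1] also covers [n = 0], where stacks of
    size [T] are still nonempty. *)
Definition loop_bound : {poly nat} := ('X + 1) ^+ C.+1 *+ 6.

Lemma loop_boundE n : loop_bound.[n] = (6 * (n.+1 * n.+1 ^ C))%N.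
Proof.
rewrite /loop_bound hornerMn horner_exp !hornerE.
have -> : (n + 1) ^+ C.+1 = (n.+1 * n.+1 ^ C)%N.
  by rewrite -expnS; elim: C.+1 => //= c IH; rewrite exprS IH expnS -addn1.
by rewrite !mulrS mulr0n /=; lia.
Qed.

Lemma polytime_tester (A : forall n, {set 'I_n}) :
  polytime_algorithm (t := fun n => copies.[n]) (a := fun n => (T n + T n)%N) A
    (fun n => tester (A n) (copy_l (copiesE n)) (copy_r (copiesE n))).
Proof.
split=> [n|].
  apply: tester_wf => i j; rewrite /copy_l /copy_r (inj_eq (@cast_ord_inj _ _ _)).
  by rewrite eq_lrshift.
have [p1 h1] := cost_poly (setup C); have [p2 h2] := cost_poly write_tester.
exists (generator C), ((p1 \Po loop_bound) + ((p2 \Po loop_bound) +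
  (loop_bound * 5 + 1 + ((p2 \Po loop_bound) * 5 + 1)))) => n.
rewrite tester_string.
have sz : size (bipartition_string (A n)) = n.
  by rewrite size_map size_enum_ord.
have ZE := loop_boundE n.
have kC k : (k <= C)%N -> (n ^ k <= n.+1 ^ C)%N.
  move=> kC; apply: (@leq_trans (n.+1 ^ k)); last by rewrite leq_pexp2l.
  by case: k kC => // k _; rewrite leq_exp2r.
have M0 : (0 < n.+1 ^ C)%N by rewrite expn_gt0.
have KM : (n ^ C <= n.+1 ^ C)%N by apply: kC.
have := @generator_runs C (bipartition_string (A n)) loop_bound.[n].
rewrite sz ZE => gen; have [||||T0 [s [e0 T0Z out]]] := gen.
- by move=> k /kC; move: (n ^ k)%N (n.+1 ^ C)%N M0 => x y; nia.
- by move: (n.+1 ^ C)%N M0 => y; nia.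
- by move: (n ^ C)%N (n.+1 ^ C)%N KM M0 => x y; nia.
- by move: (n ^ C)%N (n.+1 ^ C)%N KM M0 => x y; nia.
exists T0, s; split=> //; apply: leq_trans T0Z _.
rewrite !hornerD !horner_comp !hornerM !hornerC -[5]polyC_natr hornerC.
by rewrite horner_comp -h1 -h2 ZE; exact: leqnn.
Qed.

End PolynomialTime.

(** * Averages over keys *)

Section Asymptotics.
Variable R : realType.

(** The coefficients are natural numbers, so the leading term alone is at least [n]. This replaces
    [1/p(n)] by [1/n]. *)
Lemma leq_nonconstant_poly (p : {poly nat}) n : (1 < size p)%N -> (n <= p.[n])%N.
Proof.
move=> sp; rewrite horner_coef; have h : ((size p).-1 < size p)%N by case: (size p) sp.
rewrite (bigD1 (Ordinal h)) //=; apply: leq_trans (leq_addr _ _).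
have p0 : (0 < lead_coef p)%N.
  by rewrite lt0n lead_coef_eq0 -size_poly_gt0 ltnW.
rewrite -[_`_(size p).-1]/(lead_coef p); apply: leq_trans (leq_pmull _ p0).
have -> : n ^+ (size p).-1 = (n ^ (size p).-1)%N.
  by elim: _.-1 => //= m IH; rewrite exprS IH expnS.
case: n => // n; rewrite -{1}[n.+1]expn1 leq_pexp2l //.
by case: (size p) sp => // -[].
Qed.

Section KeyAverages.
Variable m : nat.
Implicit Types (E : bits 'I_m -> Prop) (F : bits 'I_m -> R).

Lemma card_keys_gt0 : 0 < #|{: bits 'I_m}|%:R :> R.
Proof. by rewrite ltr0n card_ffun card_bool expn_gt0. Qed.

Lemma mean_key_le F F' : (forall k, F k <= F' k) -> mean_key F <= mean_key F'.
Proof.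
by move=> h; rewrite /mean_key ler_pM2r ?invr_gt0 ?card_keys_gt0 // ler_sum.
Qed.

Lemma prob_keyE E : prob_key R E = mean_key (fun k => (`[< E k >])%:R).
Proof.
rewrite /prob_key /mean_key; congr (_ / _).
rewrite -sum1_card natr_sum big_mkcond /=; apply: eq_bigr => k _.
case: (asboolP (E k)) => h.
  by rewrite ifT //; apply/mem_set/asboolP.
by rewrite ifF //; apply/negbTE/negP => /set_mem/asboolP.
Qed.

Lemma mean_keyZ a F : mean_key (fun k => a * F k) = a * mean_key F.
Proof. by rewrite /mean_key -mulr_sumr mulrA. Qed.

Lemma mean_keyD F F' : mean_key (fun k => F k + F' k) = mean_key F + mean_key F'.
Proof. by rewrite /mean_key big_split mulrDl. Qed.

Lemma mean_key_cst (a : R) : mean_key (fun _ : bits 'I_m => a) = a.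
Proof.
by rewrite /mean_key sumr_const -(mulr_natr a) mulfK // gt_eqF // card_keys_gt0.
Qed.

Lemma mean_key_ge_prob E F (a : R) : (forall k, 0 <= F k) -> (forall k, E k -> a <= F k) ->
  a * prob_key R E <= mean_key F.
Proof.
move=> F0 h; rewrite prob_keyE -mean_keyZ; apply: mean_key_le => k.
by case: asboolP => [/h|_]; rewrite ?mulr1 ?mulr0.
Qed.

Lemma mean_key_le_prob E F (a : R) : 0 <= a -> (forall k, F k <= 1) ->
  (forall k, E k -> F k <= a) -> mean_key F <= a + (1 - prob_key R E).
Proof.
move=> a0 F1 h; have -> : a + (1 - prob_key R E) =
    mean_key (fun k : bits 'I_m => (a + 1) + (-1) * (`[< E k >])%:R).
  by rewrite mean_keyD mean_keyZ mean_key_cst -prob_keyE mulN1r addrA.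
apply: mean_key_le => k; case: asboolP => [/h|_].
  by rewrite mulr1 addrK.
by rewrite mulr0 addr0; apply: le_trans (F1 k) _; rewrite lerDr.
Qed.

Lemma prob_key_ex E : 0 < prob_key R E -> exists k, E k.
Proof.
move=> h; apply: contrapT => nE; move: h; rewrite prob_keyE.
have -> : (fun k => (`[< E k >])%:R) = (fun _ : bits 'I_m => 0 : R).
  by apply/funext => k; case: asboolP => // Ek; case: nE; exists k.
by rewrite mean_key_cst ltxx.
Qed.

End KeyAverages.

Lemma negativity_ge0 n (A : {set 'I_n}) (rho : op R 'I_n) : density rho ->
  0 <= negativity A rho.
Proof. by move=> dr; rewrite ln_ge0 // trnorm_ptranspose_ge1. Qed.

(** The trace norm is at least 1, hence below its square, which is at most [2^n <= exp n]. *)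
Lemma negativity_le n (A : {set 'I_n}) (rho : op R 'I_n) : density rho ->
  negativity A rho <= n%:R.
Proof.
move=> dr; have t1 := trnorm_ptranspose_ge1 A dr.
have t0 : 0 < trnorm (ptranspose A rho) by apply: lt_le_trans t1.
rewrite -ler_expR lnK //; apply: (@le_trans _ _ (2 ^+ n)).
  apply: le_trans (trnorm_ptranspose_sq_le A dr).
  by rewrite expr2 ler_peMl // ltW.
rewrite -[n%:R]mulr1 expRM_natl.
apply: lerXn2r; rewrite ?nnegrE ?expR_ge0 //.
by have := expR_ge1Dx (1 : R); rewrite -natr1 addrC.
Qed.

(** The logarithm of [purity_le_trnorm_ptranspose]; the factor 2 undoes the square root of the
    purity. *)
Lemma side_purity_ge n (A : {set 'I_n}) (rho : op R 'I_n) : density rho ->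
  - 2 * (S2 rho + negativity A rho) <= ln (side_purity A rho).
Proof.
move=> dr; have P0 := side_purity_gt0 A dr.
have t1 := trnorm_ptranspose_ge1 A dr.
have t0 : 0 < trnorm (ptranspose A rho) by apply: lt_le_trans t1.
have r0 := density_purity_gt0 dr.
have s0 : 0 < Num.sqrt (side_purity A rho) by rewrite sqrtr_gt0.
have := purity_le_trnorm_ptranspose A dr.
rewrite -ler_ln ?posrE ?mulr_gt0 // lnM ?posrE // => h.
have -> : ln (side_purity A rho) = 2 * ln (Num.sqrt (side_purity A rho)).
  by rewrite -{1}(sqr_sqrtr (ltW P0)) lnXn // mulr_natl.
by rewrite /S2 /negativity; lra.
Qed.

Lemma side_purity_le n (A : {set 'I_n}) (rho : op R 'I_n) (x : R) : density rho ->
  (x%:E <= fidelity_of_separability A rho)%E -> x <= - ln (side_purity A rho).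
Proof.
by move=> dr h; rewrite -lee_fin; apply: le_trans h (fidelity_of_separability_le A dr).
Qed.

End Asymptotics.

(** * Mean acceptance over the keys *)

Section GoodKeys.
Variables (R : realType) (kappa : nat -> nat) (A : forall n, {set 'I_n}).
Implicit Types (rho : ensemble R kappa) (h : nat -> R).

Definition good_key rho h (c d : R) n (k : bits 'I_(kappa n)) : Prop :=
  [/\ c * h n <= negativity (A n) (rho n k) <= d * h n
    & ((c * h n)%:E <= fidelity_of_separability (A n) (rho n k))%E].

Lemma entanglement_good_keys rho h : entanglement_Theta A rho h ->
  exists c d : R, [/\ 0 < c, 0 < d & \forall n \near \oo,
    1 - n%:R^-1 <= prob_key R (good_key rho h c d (n := n))].
Proof.
move=> [c [d [p [c0 d0 sp H]]]]; exists c, d; split=> //.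
near=> n.
have n0 : (0 < n)%N by near: n; exact: nbhs_infty_gt.
have pn := leq_nonconstant_poly n sp.
apply: (@le_trans _ _ (1 - (p.[n]%:R)^-1)).
  by rewrite lerD2l lerN2 lef_pV2 ?posrE ?ltr0n ?ler_nat // (leq_trans n0).
apply: (@le_trans _ _ (prob_key R (fun k : bits 'I_(kappa n) =>
          [/\ c * h n <= negativity (A n) (rho n k) <= d * h n
            & ((c * h n)%:E <= fidelity_of_separability (A n) (rho n k)
                 <= (d * h n)%:E)%E]))); first by near: n.
rewrite !prob_keyE; apply: mean_key_le => k.
case: asboolP => [[h1 /andP[h2 _]]|_]; last by rewrite ler0n.
by case: asboolP => // -[].
Unshelve. all: by end_near.
Qed.

(** For large [n] a good key exists, and its negativity lies between 0 and [n]. *)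
Lemma entanglement_bounds rho h : (forall n k, density (rho n k)) ->
  entanglement_Theta A rho h ->
  exists2 c : R, 0 < c & \forall n \near \oo, 0 <= h n <= c * n%:R.
Proof.
move=> drho /entanglement_good_keys[c [d [c0 d0 H]]]; exists c^-1.
  by rewrite invr_gt0.
near=> n.
have n1 : (1 < n)%N by near: n; exact: nbhs_infty_gt.
have [|k [/andP[lo hi] _]] := @prob_key_ex R _ (good_key rho h c d (n := n)).
  apply: (@lt_le_trans _ _ (1 - n%:R^-1)); last by near: n.
  by rewrite subr_gt0 invf_lt1 ?ltr1n ?ltr0n // ltnW.
apply/andP; split.
  by rewrite -(pmulr_rge0 _ d0) (le_trans _ hi) // negativity_ge0.
by rewrite mulrC ler_pdivlMr // mulrC (le_trans lo) // negativity_le.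
Unshelve. all: by end_near.
Qed.

Definition tester_mean (K : nat) n rho : R :=
  mean_key (fun k : bits 'I_(kappa n) =>
    majority_prob K (side_purity (A n) (rho n k))).

Lemma side_purity01 n (B : {set 'I_n}) (r : op R 'I_n) : density r ->
  0 <= side_purity B r <= 1.
Proof. by move=> dr; rewrite ltW ?side_purity_gt0 // side_purity_le1. Qed.

Lemma leq_doubleS3 x : (0 < x)%N -> (x.*2.+1 <= 3 * x)%N.
Proof. lia. Qed.

(* High entanglement: the outcomes of the swap tests are nearly unbiased.     *)
Lemma tester_mean_high rho h (C : nat) : (forall n k, density (rho n k)) ->
  entanglement_Theta A rho h -> (fun n : nat => ln (n%:R : R)) =o_\oo h ->
  \forall n \near \oo,
    (1 - 3 * n%:R^-1) / 2 * (1 - n%:R^-1) <= tester_mean (n ^ C) n rho.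
Proof.
move=> drho eh lnh; have [c' c'0 hb] := entanglement_bounds drho eh.
have [c [d [c0 d0 H]]] := entanglement_good_keys eh.
(* With this constant [(C + 1) ln n <= c h(n) <= - ln P] on good keys, that is [P <= n^(-C-1)],
   whence [T P <= 3/n]. *)
have eps0 : 0 < c / C.+1%:R by rewrite divr_gt0.
have /eqoP/(_ _ eps0) lnh' := lnh.
near=> n.
have n3 : (3 < n)%N by near: n; exact: nbhs_infty_gt.
have n0 : (0 : R) < n%:R by rewrite ltr0n; lia.
have x3 : 3 * n%:R^-1 <= (1 : R) by rewrite ler_pdivrMr // mul1r ler_nat ltnW.
have x1 : n%:R^-1 <= (1 : R) by rewrite invf_le1 // ler1n; lia.
have H' : 1 - n%:R^-1 <= prob_key R (good_key rho h c d (n := n)).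
  by near: n.
have /andP[h0 _] : 0 <= h n <= c' * n%:R by near: n.
have lnh'' : `|ln (n%:R : R)| <= c / C.+1%:R * `|h n| by near: n.
apply: (@le_trans _ _ ((1 - 3 * n%:R^-1) / 2 * prob_key R (good_key rho h c d (n := n)))).
  by rewrite ler_wpM2l // divr_ge0 // subr_ge0.
apply: mean_key_ge_prob => k; first exact/majority_prob_ge0/side_purity01.
move=> [_ /side_purity_le -/(_ (drho n k)) hP].
apply: le_trans (majority_prob_ge _ (side_purity01 _ (drho n k))).
set P := side_purity _ _ in hP *.
have P0 : 0 < P by apply: side_purity_gt0.
rewrite ler_pM2r ?invr_gt0 // lerD2l lerN2.
have Pn : P <= (n%:R ^+ C.+1)^-1.
  rewrite -ler_ln ?posrE ?invr_gt0 ?exprn_gt0 // lnV ?posrE ?exprn_gt0 //.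
  rewrite lnXn // lerNr; apply: le_trans hP.
  have := lnh''; rewrite ger0_norm; last by rewrite ln_ge0 // ler1n (leq_trans _ n3).
  rewrite (ger0_norm h0) mulrAC ler_pdivlMr // => hh.
  by rewrite -(mulr_natr (ln _)).
apply: (@le_trans _ _ ((n ^ C).*2.+1%:R * (n%:R ^+ C.+1)^-1)).
  by rewrite ler_wpM2l ?ler0n.
rewrite exprS invfM (mulrC n%:R^-1) mulrA ler_pM2r ?invr_gt0 //.
rewrite ler_pdivrMr ?exprn_gt0 // -natrX -natrM ler_nat.
by apply: leq_doubleS3; rewrite expn_gt0 (leq_trans _ n3).
Unshelve. all: by end_near.
Qed.

(* Low entanglement and low entropy: the bias of the swap tests is at least   *)
(* an inverse polynomial.                                                     *)
Lemma tester_mean_low rho h : (forall n k, density (rho n k)) ->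
  entanglement_Theta A rho h -> entropy_logarithmic rho ->
  h =O_\oo (fun n : nat => ln (n%:R : R)) ->
  exists C, \forall n \near \oo, tester_mean (n ^ C) n rho <= 2 * n%:R^-1.
Proof.
move=> drho eh [s hs] /eqO_exP[M M0 hM].
have [c [d [c0 d0 H]]] := entanglement_good_keys eh.
(* By [side_purity_ge], [- ln P <= 2 (s + d M) ln n] on good keys, so [P >= n^(-b)]. *)
have [b hb] : exists b : nat, 2 * (s + d * M) <= b%:R.
  exists (Num.bound `|2 * (s + d * M)|).
  exact/ltW/(le_lt_trans (ler_norm _))/archi_boundP.
(* The exponent [2 b + 1] makes [n^(2b+1) P^2 >= n], so good keys accept with probability at most
   [1/(1 + n)]. *)
exists (b.*2.+1); near=> n.
have n1 : (1 < n)%N by near: n; exact: nbhs_infty_gt.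
have n0 : (0 : R) < n%:R by rewrite ltr0n ltnW.
have ln0 : 0 <= ln (n%:R : R) by rewrite ln_ge0 // ler1n ltnW.
have H' : 1 - n%:R^-1 <= prob_key R (good_key rho h c d (n := n)).
  by near: n.
have hsn : forall k, S2 (rho n k) <= s * ln n%:R by near: n.
have hMn : `|h n| <= M * `|ln (n%:R : R)| by near: n.
apply: (@le_trans _ _ (n%:R^-1 + (1 - prob_key R (good_key rho h c d (n := n))))).
  apply: mean_key_le_prob => [|k|k]; first by rewrite invr_ge0 ltW.
    exact/majority_prob_le1/side_purity01.
  move=> [/andP[_ hE] _].
  apply: le_trans (majority_prob_le _ (side_purity01 _ (drho n k))) _.
  have P0 := side_purity_gt0 (A n) (drho n k).
  have hP := side_purity_ge (A n) (drho n k).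
  set P := side_purity _ _ in P0 hP *.
  have Pn : (n%:R ^+ b)^-1 <= P.
    rewrite -ler_ln ?posrE ?invr_gt0 ?exprn_gt0 // lnV ?posrE ?exprn_gt0 //.
    rewrite lnXn //; apply: le_trans hP; rewrite mulNr lerN2 -mulr_natl.
    have hh : h n <= M * ln n%:R.
      by rewrite (le_trans (ler_norm _)) // -[in leRHS](ger0_norm ln0).
    have dh : d * h n <= d * (M * ln n%:R) by rewrite ler_pM2l.
    have := hsn k; have := ler_wpM2r ln0 hb; lra.
  have P0' := ltW P0.
  rewrite lef_pV2 ?posrE ?ltr_wpDr ?mulr_ge0 ?ler0n ?sqr_ge0 //.
  apply: (@le_trans _ _ ((n ^ b.*2.+1)%:R * P ^+ 2)); last by rewrite lerDr.
  apply: (@le_trans _ _ ((n ^ b.*2.+1)%:R * (n%:R ^+ b)^-1 ^+ 2)).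
    rewrite natrX exprS -mul2n mulnC exprM exprVn mulfK //.
    by rewrite expf_neq0 // expf_neq0 // gt_eqF.
  by rewrite ler_wpM2l ?ler0n // ler_pXn2r // nnegrE ?invr_ge0 ?exprn_ge0 // ltW.
by rewrite mulr_natl mulr2n lerD2l lerBlDr -lerBlDl; exact: H'.
Unshelve. all: by end_near.
Qed.

End GoodKeys.

Theorem proposition2 (R : realType) (A : forall n, {set 'I_n})
    (kappa : nat -> nat) (rho sigma : ensemble R kappa) (f g : nat -> R)
    (h_pe : pseudoentangled A rho sigma f g)
    (h_rho : entropy_logarithmic rho) (h_sigma : entropy_logarithmic sigma) :
  f =O_\oo (fun n : nat => n%:R : R) /\
  ~ (g =O_\oo (fun n : nat => ln (n%:R : R)) /\
     (fun n : nat => ln (n%:R : R)) =o_\oo f).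
Proof.
case: h_pe => _ dens _ [ent_rho ent_sigma] indist.
have drho n k : density (rho n k) by case: (dens n k).
have dsigma n k : density (sigma n k) by case: (dens n k).
split.
  have [c c0 H] := entanglement_bounds drho ent_rho.
  apply/eqO_exP; exists c => //; near=> n.
  have /andP[f0 fn] : 0 <= f n <= c * n%:R by near: n.
  by rewrite !ger0_norm.
move=> [g_low f_high].
(* The low ensemble dictates the number of tests; [tester_mean_high] holds for every exponent. *)
have [C low] := tester_mean_low dsigma ent_sigma h_sigma g_low.
have high := tester_mean_high C drho ent_rho f_high.
have negl := indist _ _ _ (polytime_tester C A) 1%N.
near \oo => n.
(* With [x = 1/n] the estimates combine to [(1 - 3 x) (1 - x) / 2 <= 3 x], that is
   [1 + 3 x^2 <= 10 x], which is false once [10 x < 1]. *)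
have n10 : (10 < n)%N by near: n; exact: nbhs_infty_gt.
have n0 : (0 : R) < n%:R by rewrite ltr0n; lia.
have x10 : 10 * n%:R^-1 < (1 : R) by rewrite ltr_pdivrMr // mul1r ltr_nat.
have x0 : 0 < n%:R^-1 :> R by rewrite invr_gt0.
have lown : tester_mean A (n ^ C) n sigma <= 2 * n%:R^-1 by near: n.
have highn : (1 - 3 * n%:R^-1) / 2 * (1 - n%:R^-1) <= tester_mean A (n ^ C) n rho.
  by near: n.
have : `|tester_mean A (n ^ C) n rho - tester_mean A (n ^ C) n sigma| <= n%:R^-1.
  have acc (r : ensemble R kappa) : (forall n k, density (r n k)) ->
      tester_mean A (n ^ C) n r = mean_key (fun k : bits 'I_(kappa n) => accept_prob
         (tester (A n) (copy_l (copiesE C n)) (copy_r (copiesE C n)))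
         (tensor_power (copies C).[n] (r n k))).
    by move=> dr; congr mean_key; apply/funext => k; rewrite tester_accept.
  (* [negligible] takes one more absolute value; its exponent 1 gives the bound [1/n]. *)
  by rewrite !acc // -[leLHS]normr_id -[n%:R in leRHS]expr1; near: n.
move=> /(le_trans (ler_norm _)) diff.
move: n%:R^-1 x10 x0 lown highn diff => x x10 x0.
move: (tester_mean _ _ _ rho) (tester_mean _ _ _ sigma) => F G lown highn diff.
have : (1 - 3 * x) / 2 * (1 - x) <= 3 * x by lra.
by rewrite -subr_ge0; nra.
Unshelve. all: by end_near.
Qed.
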